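(* Let $f$ be analytic in a disk $D_r$ around the origin of radius $r>0$. Furthermore, let $\Gamma$ be the concatenation of a straight line from $\infty \times e^{\frac{5i\pi}{6}}$ to $0$ and a straight line from $0$ to $\infty \times e^{\frac{i\pi}{6}}$. Finally, let $\tilde{\Gamma} = \Gamma \cap D_r$ and consider the integral $$I_{\tilde{\Gamma}}[f] = \int_{\tilde{\Gamma}} f(z)\, e^{i\omega\left(\frac{z^3}{3} - cz\right)}\, dz .$$ Assume that the monic polynomial $p_{n,\delta}$ of degree $n$ satisfies $$\int_\Gamma p_{n,\delta}(z)\, z^k\, e^{i\left(\frac{z^3}{3} - \delta z\right)}\, dz = 0, \qquad k=0,\ldots,n-1,$$ with $\delta = c\,\omega^{2/3}$, and that it has $n$ distinct finite roots $t_{1,\delta},\ldots,t_{n,\delta}$. Let $Q[f]$ be the quadrature rule $$Q[f] = \frac{1}{\omega^{1/3}} \sum_{k=1}^n w_{k,\delta}\, f\!\left(\frac{t_{k,\delta}}{\omega^{1/3}}\right), \qquad w_{k,\delta} = \int_\Gamma \frac{p_{n,\delta}(z)}{(z-t_{k,\delta})\,p_{n,\delta}'(t_{k,\delta})}\, e^{i\left(\frac{z^3}{3}-\delta z\right)}\, dz .$$ For fixed $\delta$ and increasing $\omega$, which implies $c = \mathcal{O}(\omega^{-2/3})$, the error for the quadrature rule $Q[f]$ is $$I_{\tilde{\Gamma}}[f] - Q[f] = \mathcal{O}\left(\omega^{-\frac{2n+1}{3}}\right), \qquad \omega \to \infty .$$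
   Context: Here $\omega>0$ is a frequency parameter, and $c$ and $\delta$ are real parameters related by $\delta = c\,\omega^{2/3}$. The contour $\tilde\Gamma$ is the part of $\Gamma$ lying in the disk $D_r$, traversed in the direction of $\Gamma$. The points $t_{k,\delta}$ and weights $w_{k,\delta}$ are those of the $n$-point Gaussian quadrature rule for the weight $e^{i(z^3/3-\delta z)}$ on $\Gamma$; for fixed $\delta$ they do not depend on $\omega$, and the points $t_{k,\delta}/\omega^{1/3}$ lie in $D_r$ for all sufficiently large $\omega$. *)

(* Defs.v *)
From Stdlib Require Import Reals.
From Coquelicot Require Import Coquelicot.
Open Scope R_scope.
Open Scope C_scope.

Definition Cexp (z : C) : C :=
  RtoC (exp (Re z)) * (cos (Im z), sin (Im z)).

(* Coquelicot's [is_pseries a h l] says that sum_k a_k h^k converges to l. *)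
Definition analytic_in_disk (f : C -> C) (r : R) : Prop :=
  forall z0 : C, (Cmod z0 < r)%R ->
  exists (a : nat -> C) (rho : posreal),
  forall z : C, (Cmod (z - z0) < rho)%R ->
  is_pseries (K := C_AbsRing) (V := C_NormedModule) a (z - z0) (f z).

Definition monic_poly (n : nat) (p : C -> C) : Prop :=
  exists a : nat -> C,
  a n = RtoC 1 /\ forall z : C, p z = sum_n (fun j => a j * z ^ j) n.

(* g(z) dz pulled back to the ray z = s e^{i theta}. *)
Definition on_ray (theta : R) (g : C -> C) (s : R) : C :=
  g (RtoC s * Cexp (Ci * RtoC theta)) * Cexp (Ci * RtoC theta).

(* The contour comes in to 0 along arg z = 5 pi / 6 and goes out along
   arg z = pi / 6.  [F] is the filter along which |z| tends to its outer limit: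
   [Rbar_locally p_infty] for the whole contour Gamma, [at_left r] for its part
   in the open disk of radius r.  In the second case the integral is improper
   at |z| = r, because f need not be bounded near the boundary of the disk. *)
Definition ex_contour_int (F : (R -> Prop) -> Prop) (g : C -> C) : Prop :=
  ex_RInt_gen (V := C_R_NormedModule)
    (on_ray (5 * PI / 6) g) F (at_point 0%R) /\
  ex_RInt_gen (V := C_R_NormedModule)
    (on_ray (PI / 6) g) (at_point 0%R) F.

Definition contour_int (F : (R -> Prop) -> Prop) (g : C -> C) : C :=
  RInt_gen (V := C_R_CompleteNormedModule)
    (on_ray (5 * PI / 6) g) F (at_point 0%R) +
  RInt_gen (V := C_R_CompleteNormedModule)
    (on_ray (PI / 6) g) (at_point 0%R) F.

Definition int_Gamma (g : C -> C) : C := contour_int (Rbar_locally p_infty) g.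

Definition ex_int_Gamma_disk (r : R) (g : C -> C) : Prop :=
  ex_contour_int (at_left r) g.

Definition int_Gamma_disk (r : R) (g : C -> C) : C :=
  contour_int (at_left r) g.

Definition oscillator (omega c : R) (z : C) : C :=
  Cexp (Ci * RtoC omega * (z ^ 3 / RtoC 3 - RtoC c * z)).

Definition gauss_weight (delta : R) (z : C) : C :=
  Cexp (Ci * (z ^ 3 / RtoC 3 - RtoC delta * z)).

(* At z = tk the quotient takes an arbitrary value (division is total); this
   affects the integrand at one point at most. *)
Definition quad_weight (delta : R) (p : C -> C) (tk : C) : C :=
  int_Gamma (fun z => p z / ((z - tk) * C_derive p tk) * gauss_weight delta z).

Definition quad (n : nat) (delta : R) (p : C -> C) (t : nat -> C)
    (omega : R) (f : C -> C) : C :=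
  / RtoC (Rpower omega (1 / 3)) *
  sum_n_m (fun k => quad_weight delta p (t k) *
                    f (t k / RtoC (Rpower omega (1 / 3)))) 1 n.

Definition bigO_infty (E : R -> C) (g : R -> R) : Prop :=
  exists M : R,
  Rbar_locally p_infty (fun omega => (Cmod (E omega) <= M * Rabs (g omega))%R).

(* Main.v *)
Require Import Defs.
From Stdlib Require Import Reals Lra Lia IndefiniteDescription.
From Coquelicot Require Import Coquelicot.
Open Scope R_scope.
Open Scope C_scope.

(* Put L = omega^(1/3) and substitute z = u / L, which turns the oscillator into
   the Gauss weight, of size exp(- u^3/3 + delta u/2) on both rays.
   Near 0 replace f(u/L) by its Taylor polynomial of degree 2n - 1 in u/L: the
   remainder costs O(L^(-2n)), extending the polynomial integral to the whole of
   Gamma costs something exponentially small, and the factor du / L supplies the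
   last power of L. The rule is exact on that polynomial (Lagrange interpolation
   at the roots of p, and orthogonality of p), and its value there differs from
   Q[f] by O(L^(-2n-1)), because the scaled nodes tend to 0.
   The part of the disk integral away from 0 is exponentially small, although f
   may be unbounded near |z| = r: convergence for omega = 1 makes the
   antiderivative of the integrand bounded there, and integration by parts moves
   all the dependence on omega into a smooth, exponentially small factor. *)

(** With [delta] fixed, c = delta omega^(-2/3), so after the rescaling the weight function, the
    nodes and the quadrature weights are all independent of L; L survives only in the argument of
    [f] and in the endpoint of the rays. Orthogonality up to degree n - 1 buys exactness up to
    degree 2n - 1, which fixes the number N = 2n of Taylor terms. The integral up to |z| = r is only
    assumed to converge, so it is never rescaled as a whole: the rescaling is done on a compact
    piece [0, r0], and the rest is compared with the case omega = 1 through the quotient of the two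
    oscillators. Integrals are carried as relations that record convergence together with the value,
    because [RInt_gen] is total and its value alone says nothing about convergence. Both rays go
    through one argument, with direction x + i/2 and x^2 = 3/4. *)

Local Notation CR := C_R_NormedModule.

(** * Complex-valued functions of a real variable *)

(** Balls of [CR] are squares, those of the product structure, while estimates are made with [Cmod];
    a square of half-side d lies in a disk of radius sqrt 2 times d. *)
Lemma ball_Cmod (eps : R) : (0 < eps)%R ->
  exists d : posreal, forall u v : C, ball (M := CR) u d v -> (Cmod (v - u) < eps)%R.
Proof.
  intros He.
  assert (H2 : (0 < sqrt 2)%R) by (apply sqrt_lt_R0; lra).
  exists (mkposreal _ (Rdiv_lt_0_compat _ _ He H2)). intros u v HB.
  pose proof (C_NormedModule_mixin_compat2 u v _ HB) as HC. simpl pos in HC.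
  replace (sqrt 2 * (eps / sqrt 2))%R with eps in HC by (field; lra).
  exact HC.
Qed.

Lemma filterlim_Cmod {T : Type} (F : (T -> Prop) -> Prop) (FF : Filter F) (g : T -> C) (l : C) :
  filterlim g F (locally (T := CR) l) ->
  forall eps : R, (0 < eps)%R -> F (fun s => (Cmod (g s - l) < eps)%R).
Proof.
  intros Hg eps He. destruct (ball_Cmod eps He) as [d Hd].
  generalize (proj1 (filterlim_locally (U := CR) g l) Hg d). apply filter_imp.
  intros s. apply Hd.
Qed.

(** With the lower endpoint pinned by [at_point], the product filter collapses to [F]. All epsilon
    arguments about improper integrals pass through this form. *)
Lemma is_RInt_gen_Cmod (F : (R -> Prop) -> Prop) (FF : Filter F)
  (g : R -> C) (a : R) (l : C) :
  is_RInt_gen (V := CR) g (at_point a) F l <->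
  (forall eps : R, (0 < eps)%R ->
    F (fun b => exists I : C, is_RInt (V := CR) g a b I /\ (Cmod (I - l) < eps)%R)).
Proof.
  unfold is_RInt_gen; split.
  - intros H eps He.
    destruct (ball_Cmod eps He) as [d Hd].
    destruct (proj1 (@filterlimi_locally (R * R) CR _ _ _ l) H d) as [P Q HP HQ HPQ].
    apply filter_imp with (2 := HQ); intros b Hb.
    destruct (HPQ a b HP Hb) as [I [HI HB]].
    exists I; split; [exact HI | now apply Hd].
  - intros H.
    apply (@filterlimi_locally (R * R) CR).
    { apply filter_prod_filter; [apply at_point_filter | exact FF]. }
    intros eps.
    refine (Filter_prod (at_point a) F _ (fun x => x = a) _ eq_refl (H eps (cond_pos eps)) _).
    intros x b -> [I [HI HB]].
    exists I; split; [exact HI|].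
    apply C_NormedModule_mixin_compat1; exact HB.
Qed.

(** The scalars of [CR] are real, so a complex constant is multiplied in by components. *)
Lemma is_RInt_Cmult (g : R -> C) (a b : R) (c l : C) :
  is_RInt (V := CR) g a b l -> is_RInt (V := CR) (fun s => c * g s) a b (c * l).
Proof.
  intros H.
  pose proof (is_RInt_fct_extend_fst (U := R_NormedModule) (V := R_NormedModule) g a b l H) as H1.
  pose proof (is_RInt_fct_extend_snd (U := R_NormedModule) (V := R_NormedModule) g a b l H) as H2.
  apply (is_RInt_fct_extend_pair (U := R_NormedModule) (V := R_NormedModule)).
  - exact (is_RInt_minus _ _ _ _ _ _ (is_RInt_scal _ _ _ (fst c) _ H1)
             (is_RInt_scal _ _ _ (snd c) _ H2)).
  - exact (is_RInt_plus _ _ _ _ _ _ (is_RInt_scal _ _ _ (fst c) _ H2)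
             (is_RInt_scal _ _ _ (snd c) _ H1)).
Qed.

(** Write f as its first component times the vector (1, 0) plus its second times (0, 1). *)
Lemma is_derive_pair (f : R -> C) (x : R) (l : C) :
  is_derive (fun s => fst (f s)) x (fst l) ->
  is_derive (fun s => snd (f s)) x (snd l) ->
  is_derive (V := CR) f x l.
Proof.
  intros H1 H2.
  pose proof (is_derive_scal_l (V := CR) _ x _ (1%R, 0%R) H1) as K1.
  pose proof (is_derive_scal_l (V := CR) _ x _ (0%R, 1%R) H2) as K2.
  pose proof (is_derive_plus (V := CR) _ _ x _ _ K1 K2) as K.
  apply is_derive_ext with (2 := eq_ind _ (is_derive (V := CR) _ x) K _
    ltac:(apply injective_projections; cbn; unfold scal; cbn; unfold mult, plus; cbn; ring)).
  intros s; apply injective_projections; cbn; unfold scal; cbn; unfold mult, plus; cbn; ring.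
Qed.

Lemma is_derive_fst (f : R -> C) (x : R) (l : C) :
  is_derive (V := CR) f x l -> is_derive (fun s => fst (f s)) x (fst l).
Proof.
  intros H.
  pose proof (filterdiff_linear (U := CR) (V := R_NormedModule) (F := locally (f x : CR)) (fst : CR -> R_NormedModule)
     (is_linear_fst (K := R_AbsRing) (U := R_NormedModule) (V := R_NormedModule))) as L.
  exact (filterdiff_comp' (U:=R_NormedModule) (V := CR) f _ x _ _ H L).
Qed.

Lemma is_derive_snd (f : R -> C) (x : R) (l : C) :
  is_derive (V := CR) f x l -> is_derive (fun s => snd (f s)) x (snd l).
Proof.
  intros H.
  pose proof (filterdiff_linear (U := CR) (V := R_NormedModule) (F := locally (f x : CR)) (snd : CR -> R_NormedModule)
     (is_linear_snd (U := R_NormedModule) (V := R_NormedModule))) as L.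
  exact (filterdiff_comp' (U:=R_NormedModule) (V := CR) f _ x _ _ H L).
Qed.

Lemma is_derive_Cmult (f g : R -> C) (x : R) (df dg : C) :
  is_derive (V := CR) f x df -> is_derive (V := CR) g x dg ->
  is_derive (V := CR) (fun s => f s * g s) x (df * g x + f x * dg).
Proof.
  intros Hf Hg.
  pose proof (is_derive_fst _ _ _ Hf) as F1.
  pose proof (is_derive_snd _ _ _ Hf) as F2.
  pose proof (is_derive_fst _ _ _ Hg) as G1.
  pose proof (is_derive_snd _ _ _ Hg) as G2.
  assert (M : forall (u v : R -> R) du dv, is_derive u x du -> is_derive v x dv ->
    is_derive (fun s => (u s * v s)%R) x (du * v x + u x * dv)%R).
  { intros u v du dv Hu Hv. exact (is_derive_mult u v x du dv Hu Hv Rmult_comm). }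
  apply is_derive_pair; cbn.
  - pose proof (is_derive_minus _ _ _ _ _ (M _ _ _ _ F1 G1) (M _ _ _ _ F2 G2)) as K.
    refine (eq_ind _ (is_derive _ x) K _ _).
    unfold minus, plus, opp; cbn; ring.
  - pose proof (is_derive_plus _ _ _ _ _ (M _ _ _ _ F1 G2) (M _ _ _ _ F2 G1)) as K.
    refine (eq_ind _ (is_derive _ x) K _ _).
    unfold minus, plus, opp; cbn; ring.
Qed.

Lemma continuous_pair (f : R -> C) (x : R) :
  continuous (fun s => fst (f s)) x -> continuous (fun s => snd (f s)) x ->
  continuous (U := CR) f x.
Proof.
  intros H1 H2.
  apply (filterlim_locally (U := CR)); intros eps.
  pose proof (proj1 (filterlim_locally _ _) H1 eps) as K1.
  pose proof (proj1 (filterlim_locally _ _) H2 eps) as K2.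
  generalize (filter_and _ _ K1 K2); apply filter_imp.
  intros y [B1 B2]; split; assumption.
Qed.

Lemma continuous_Cfst (g : R -> C) (x : R) :
  continuous (U := CR) g x -> continuous (fun s => fst (g s)) x.
Proof.
  intros H. apply (continuous_comp (V := CR) g fst); [exact H | destruct (g x); apply continuous_fst].
Qed.

Lemma continuous_Csnd (g : R -> C) (x : R) :
  continuous (U := CR) g x -> continuous (fun s => snd (g s)) x.
Proof.
  intros H. apply (continuous_comp (V := CR) g snd); [exact H | destruct (g x); apply continuous_snd].
Qed.

Lemma continuous_Cmult (f g : R -> C) (x : R) :
  continuous (U := CR) f x -> continuous (U := CR) g x ->
  continuous (U := CR) (fun s => f s * g s) x.
Proof.
  intros Hf Hg.
  pose proof (continuous_Cfst _ _ Hf) as F1. pose proof (continuous_Csnd _ _ Hf) as F2.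
  pose proof (continuous_Cfst _ _ Hg) as G1. pose proof (continuous_Csnd _ _ Hg) as G2.
  apply continuous_pair; cbn.
  - exact (continuous_minus _ _ _ (continuous_mult _ _ _ F1 G1) (continuous_mult _ _ _ F2 G2)).
  - exact (continuous_plus _ _ _ (continuous_mult _ _ _ F1 G2) (continuous_mult _ _ _ F2 G1)).
Qed.

Lemma continuous_Cplus (f g : R -> C) (x : R) :
  continuous (U := CR) f x -> continuous (U := CR) g x ->
  continuous (U := CR) (fun s => f s + g s) x.
Proof. exact (continuous_plus (V := CR) f g x). Qed.

Lemma Cmod_RInt_le (g : R -> C) (h : R -> R) (a b : R) (I : C) (J : R) :
  (a <= b)%R -> (forall s, (a <= s <= b)%R -> (Cmod (g s) <= h s)%R) ->
  is_RInt (V := CR) g a b I -> is_RInt h a b J -> (Cmod I <= J)%R.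
Proof.
  intros Hab Hgh HI HJ.
  rewrite Cmod_norm.
  apply (norm_RInt_le (V := CR) g h a b I J Hab); try assumption.
  intros s Hs. specialize (Hgh s Hs). rewrite Cmod_norm in Hgh. exact Hgh.
Qed.

Lemma is_RInt_exp_opp (K a b : R) :
  is_RInt (fun s => K * exp (- s))%R a b (K * (exp (- a) - exp (- b)))%R.
Proof.
  replace (K * (exp (- a) - exp (- b)))%R
    with (minus (- K * exp (- b)) (- K * exp (- a)))%R by (cbn; unfold minus, plus, opp; cbn; ring).
  apply (is_RInt_derive (fun s => - K * exp (- s))%R).
  - intros s _. auto_derive; [trivial|ring].
  - intros s _. apply (ex_derive_continuous (V := R_NormedModule)). auto_derive; trivial.
Qed.

(* Domination by K e^{-s} gives both the convergence of the improper integral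
   and an explicit bound for its tail. *)
Lemma dominated_improper_RInt (g : R -> C) (K : R) :
  (forall s, continuous (U := CR) g s) ->
  (forall s, (0 <= s)%R -> (Cmod (g s) <= K * exp (- s))%R) ->
  exists l : C, is_RInt_gen (V := CR) g (at_point 0%R) (Rbar_locally p_infty) l /\
  forall (b : R) (I : C), (0 <= b)%R -> is_RInt (V := CR) g 0 b I ->
  (Cmod (I - l) <= K * exp (- b))%R.
Proof.
  intros Hc Hd.
  assert (K0 : (0 <= K)%R).
  { specialize (Hd 0%R (Rle_refl 0)). rewrite Ropp_0, exp_0 in Hd.
    pose proof (Cmod_ge_0 (g 0%R)); lra. }
  set (G := fun b => RInt (V := C_R_CompleteNormedModule) g 0 b).
  assert (HG : forall b, is_RInt (V := CR) g 0 b (G b)).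
  { intros b. apply (RInt_correct (V := C_R_CompleteNormedModule)).
    apply (ex_RInt_continuous (V := C_R_CompleteNormedModule)). intros; apply Hc. }
  (* This increment bound gives both conclusions: the Cauchy property, and the tail bound once d
     tends to infinity. *)
  assert (D : forall b d, (0 <= b <= d)%R -> (Cmod (G d - G b) <= K * exp (- b))%R).
  { intros b d Hbd.
    pose proof (is_RInt_Chasles (V := CR) g b 0 d _ _ (is_RInt_swap _ _ _ _ (HG b)) (HG d)) as H1.
    replace (G d - G b) with (plus (G := CR) (opp (G := CR) (G b)) (G d))
      by (change (- G b + G d = G d - G b); ring).
    apply Rle_trans with (K * (exp (- b) - exp (- d)))%R.
    - apply (Cmod_RInt_le g (fun s => K * exp (- s))%R b d); try easy.
      + intros s Hs; apply Hd; lra.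
      + apply is_RInt_exp_opp.
    - pose proof (exp_pos (- d)). nra. }
  assert (small : forall eps, (0 < eps)%R -> exists b0, (0 <= b0)%R /\
            forall b, (b0 <= b)%R -> (K * exp (- b) < eps)%R).
  { intros eps He. exists (K / eps)%R.
    assert (HKe : (0 <= K / eps)%R) by (apply Rcomplements.Rdiv_le_0_compat; lra).
    split; [exact HKe|].
    intros b Hb. pose proof (exp_ineq1_le b) as E. pose proof (exp_pos b) as P.
    rewrite exp_Ropp. apply Rmult_lt_reg_r with (exp b); [easy|].
    rewrite Rmult_assoc, Rinv_l by lra.
    assert (K = K / eps * eps)%R by (field; lra). nra. }
  assert (L : exists l : CR, filterlim G (Rbar_locally p_infty) (locally l)).
  { apply (filterlim_locally_cauchy (U := C_R_CompleteNormedModule)).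
    intros eps.
    destruct (small (eps / 2)%R) as [b0 [Hb0 Hs]]; [destruct eps; cbn; lra|].
    exists (fun b => b0 < b)%R. split; [exists b0; easy|].
    intros u v Hu Hv.
    apply C_NormedModule_mixin_compat1.
    change (Cmod (G v - G u) < eps)%R.
    replace (G v - G u) with ((G v - G b0) - (G u - G b0)) by ring.
    eapply Rle_lt_trans; [apply Cmod_triangle|]. rewrite Cmod_opp.
    pose proof (D b0 v ltac:(lra)). pose proof (D b0 u ltac:(lra)).
    specialize (Hs b0 (Rle_refl _)). lra. }
  destruct L as [l Hl].
  pose proof (filterlim_Cmod (Rbar_locally p_infty) _ G l Hl) as Hl'.
  exists l; split.
  - apply is_RInt_gen_Cmod; [apply Rbar_locally_filter|].
    intros eps He. generalize (Hl' eps He). apply filter_imp.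
    intros b Hb. exists (G b). split; [apply HG | exact Hb].
  - intros b I Hb HI.
    replace I with (G b) by (apply (is_RInt_unique (V := C_R_CompleteNormedModule)); exact HI).
    apply le_epsilon. intros eps He.
    destruct (Hl' eps He) as [b1 Hb1].
    set (d := (Rmax b b1 + 1)%R).
    pose proof (Rmax_l b b1). pose proof (Rmax_r b b1).
    specialize (Hb1 d ltac:(unfold d; lra)).
    replace (G b - l) with (- (G d - G b) + (G d - l)) by ring.
    eapply Rle_trans; [apply Cmod_triangle|]. rewrite Cmod_opp.
    pose proof (D b d ltac:(unfold d; lra)). lra.
Qed.

(** * Polynomial functions and Gaussian quadrature *)

(* [q] is a polynomial function of degree at most [m] whose coefficient of
   [z ^ m] is [l], in Horner form. *)
Fixpoint poly_lead (m : nat) (l : C) (q : C -> C) : Prop :=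
  match m with
  | O => forall z, q z = l
  | S m' => exists (c : C) (q1 : C -> C),
      poly_lead m' l q1 /\ forall z, q z = c + z * q1 z
  end.

Lemma poly_lead_ext (m : nat) (l : C) (q q' : C -> C) :
  (forall z, q z = q' z) -> poly_lead m l q -> poly_lead m l q'.
Proof.
  intros E H. destruct m; cbn in *.
  - intros z. now rewrite <- E.
  - destruct H as [c [q1 [H1 H2]]]. exists c, q1. split; [easy|].
    intros z. now rewrite <- E.
Qed.

Lemma poly_lead_combine (m : nat) : forall (l l' a b : C) (q q' : C -> C),
  poly_lead m l q -> poly_lead m l' q' ->
  poly_lead m (a * l + b * l') (fun z => a * q z + b * q' z).
Proof.
  induction m as [|m IH]; intros l l' a b q q'; cbn.
  - intros H H' z. now rewrite H, H'.
  - intros [c [q1 [H1 H2]]] [c' [q1' [H1' H2']]].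
    exists (a * c + b * c'), (fun z => a * q1 z + b * q1' z). split.
    + now apply IH.
    + intros z. rewrite H2, H2'. ring.
Qed.

Lemma poly_lead_pad (m : nat) : forall (l : C) (q : C -> C),
  poly_lead m l q -> poly_lead (S m) 0 q.
Proof.
  induction m as [|m IH]; intros l q H.
  - exists l, (fun _ => 0). split; [easy|]. intros z. cbn in H. rewrite H. ring.
  - destruct H as [c [q1 [H1 H2]]]. exists c, q1. split; [|easy]. now apply (IH l).
Qed.

Lemma poly_lead_le (m m' : nat) (l : C) (q : C -> C) :
  (m <= m')%nat -> poly_lead m l q -> exists l', poly_lead m' l' q.
Proof.
  intros Hm H. induction Hm as [|m' Hm [l' IH]].
  - now exists l.
  - exists 0. now apply (poly_lead_pad m' l').
Qed.

(** Used to lower the degree after a multiple of [p] has cancelled the top coefficient. *)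
Lemma poly_lead_zero (m : nat) : forall q : C -> C,
  poly_lead (S m) 0 q -> exists l, poly_lead m l q.
Proof.
  induction m as [|m IH]; intros q [c [q1 [H1 H2]]].
  - exists c. intros z. cbn in H1. rewrite H2, H1. ring.
  - destruct (IH q1 H1) as [l Hl]. exists l, c, q1. now split.
Qed.

Lemma poly_lead_shift (m k : nat) (l : C) (q : C -> C) :
  poly_lead m l q -> poly_lead (m + k) l (fun z => q z * z ^ k).
Proof.
  intros H. induction k as [|k IH].
  - rewrite Nat.add_0_r. apply (poly_lead_ext m l q); [|easy].
    intros z. cbn. ring.
  - rewrite Nat.add_succ_r. exists 0, (fun z => q z * z ^ k). split; [easy|].
    intros z. rewrite Cpow_S. ring.
Qed.

Lemma poly_lead_pow (k : nat) : poly_lead k 1 (fun z => z ^ k).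
Proof.
  apply (poly_lead_ext _ _ (fun z => 1 * z ^ k)).
  { intros z. ring. }
  exact (poly_lead_shift 0 k 1 (fun _ => 1) (fun _ => eq_refl)).
Qed.

(** Synthetic division. The quotient keeps the top coefficient, so quotients of a monic polynomial
    remain monic. *)
Lemma poly_lead_divide (m : nat) : forall (l t : C) (q : C -> C),
  poly_lead (S m) l q ->
  exists q1, poly_lead m l q1 /\ forall z, q z = (z - t) * q1 z + q t.
Proof.
  induction m as [|m IH]; intros l t q [c [q0 [H1 H2]]].
  - exists q0. split; [easy|]. intros z. cbn in H1. rewrite !H2, !H1. ring.
  - destruct (IH l t q0 H1) as [q1 [K1 K2]].
    exists (fun z => q0 t + z * q1 z). split.
    + now exists (q0 t), q1.
    + intros z. rewrite !H2, (K2 z). ring.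
Qed.

(** Divide out the last node: the other nodes differ from it, so they remain zeros of the quotient,
    whose degree has dropped by one. The conclusion l = 0 serves to contradict l = 1. *)
Lemma poly_lead_vanish (m : nat) : forall (l : C) (q : C -> C) (t : nat -> C),
  poly_lead m l q ->
  (forall j k, (1 <= j <= S m)%nat -> (1 <= k <= S m)%nat -> t j = t k -> j = k) ->
  (forall k, (1 <= k <= S m)%nat -> q (t k) = 0) ->
  l = 0 /\ forall z, q z = 0.
Proof.
  induction m as [|m IH]; intros l q t H Ht Hq.
  - cbn in H. pose proof (Hq 1%nat ltac:(lia)) as Z. rewrite H in Z.
    split; [easy|]. intros z. now rewrite H.
  - destruct (poly_lead_divide m l (t (S (S m))) q H) as [q1 [H1 H2]].
    rewrite (Hq (S (S m))) in H2 by lia.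
    destruct (IH l q1 t H1) as [Hl Hz].
    + intros j k Hj Hk. apply Ht; lia.
    + intros k Hk. pose proof (Hq k ltac:(lia)) as Z. rewrite H2 in Z.
      assert (N : t k - t (S (S m)) <> 0).
      { apply Cminus_eq_contra. intros E. apply Ht in E; lia. }
      replace (q1 (t k)) with
        (/ (t k - t (S (S m))) * ((t k - t (S (S m))) * q1 (t k) + 0))
        by (field; exact N).
      rewrite Z. ring.
    + split; [easy|]. intros z. rewrite H2, Hz. ring.
Qed.

Lemma monic_poly_lead (n : nat) (p : C -> C) : monic_poly n p -> poly_lead n 1 p.
Proof.
  intros [a [Ha Hp]].
  (* Induction needs an arbitrary top coefficient, since the truncated sums are not monic. *)
  enough (K : poly_lead n (a n) (fun z => sum_n (fun j => a j * z ^ j) n)).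
  { rewrite Ha in K. refine (poly_lead_ext _ _ _ _ _ K). intros z; now rewrite Hp. }
  clear Ha Hp p. induction n as [|n IH].
  - intros z. rewrite sum_O. cbn. ring.
  - apply (poly_lead_ext (S n) (a (S n))
      (fun z => 1 * sum_n (fun j => a j * z ^ j) n + a (S n) * z ^ S n)).
    { intros z. rewrite sum_Sn. change (1 * sum_n (fun j => a j * z ^ j) n + a (S n) * z ^ S n
        = sum_n (fun j => a j * z ^ j) n + a (S n) * z ^ S n). ring. }
    replace (a (S n)) with (1 * 0 + a (S n) * 1) at 1 by ring.
    apply poly_lead_combine; [|apply poly_lead_pow].
    now apply (poly_lead_pad n (a n)).
Qed.

Lemma poly_lead_continuous (m : nat) : forall (l : C) (q : C -> C) (g : R -> C) (x : R),
  poly_lead m l q -> continuous (U := CR) g x ->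
  continuous (U := CR) (fun s => q (g s)) x.
Proof.
  induction m as [|m IH]; intros l q g x H Hg.
  - apply (continuous_ext (T := R_UniformSpace) (U := CR) (fun _ => l)).
    { intros s. now rewrite H. }
    apply continuous_const.
  - destruct H as [c [q1 [H1 H2]]].
    apply (continuous_ext (T := R_UniformSpace) (U := CR) (fun s => c + g s * q1 (g s))).
    { intros s. now rewrite H2. }
    apply continuous_Cplus; [apply continuous_const|].
    apply continuous_Cmult; [easy|]. now apply (IH l).
Qed.

(** [C_lim] takes its limit along the horizontal line through t. Off t the difference quotient
    equals q there, so continuity of q on that line gives the value. *)
Lemma C_derive_factor (m : nat) (l t : C) (p q : C -> C) :
  poly_lead m l q -> (forall z, p z = (z - t) * q z) -> C_derive p t = q t.
Proof.
  intros Hq Hp. unfold C_derive, C_lim.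
  assert (Q : continuous (U := CR) (fun x => q (x, snd t)) (fst t)).
  { apply (poly_lead_continuous m l q (fun x => (x, snd t)) (fst t) Hq).
    apply continuous_pair; cbn; [apply continuous_id | apply continuous_const]. }
  assert (E : Rbar_locally' (fst t) (fun x =>
      q (x, snd t) = (p (x, snd t) - p t) / ((x, snd t) - t))).
  { exists (mkposreal 1 Rlt_0_1). intros x _ Hx.
    pose (c := (x, snd t) : C).
    change (q c = (p c - p t) / (c - t)).
    rewrite (Hp t), (Hp c). field.
    apply Cminus_eq_contra. intros K. apply Hx. now rewrite <- K. }
  rewrite (surjective_pairing (q t)).
  apply f_equal2.
  - apply (f_equal real (y := Finite (fst (q t)))), is_lim_unique.
    apply is_lim_ext_loc with (fun x => fst (q (x, snd t))).
    { revert E. apply filter_imp. intros x Hx. now rewrite Hx. }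
    pose proof (is_lim_continuity _ _ (proj2 (continuity_pt_filterlim _ _) (continuous_Cfst _ _ Q))) as K.
    cbn in K. now rewrite <- surjective_pairing in K.
  - apply (f_equal real (y := Finite (snd (q t)))), is_lim_unique.
    apply is_lim_ext_loc with (fun x => snd (q (x, snd t))).
    { revert E. apply filter_imp. intros x Hx. now rewrite Hx. }
    pose proof (is_lim_continuity _ _ (proj2 (continuity_pt_filterlim _ _) (continuous_Csnd _ _ Q))) as K.
    cbn in K. now rewrite <- surjective_pairing in K.
Qed.

(** Fixes the group structure once, so that all sums over nodes agree syntactically. *)
Definition sumC : (nat -> C) -> nat -> nat -> C := sum_n_m (G := C_AbelianGroup).

Lemma sumC_S (u : nat -> C) (n : nat) : sumC u 1 (S n) = sumC u 1 n + u (S n).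
Proof. apply (sum_n_Sm (G := C_AbelianGroup)). lia. Qed.

Lemma sumC_0 (u : nat -> C) : sumC u 1 0 = RtoC 0.
Proof. apply (sum_n_m_zero (G := C_AbelianGroup)). lia. Qed.

Lemma sumC_zero (u : nat -> C) (n : nat) :
  (forall k, (1 <= k <= n)%nat -> u k = 0) -> sumC u 1 n = RtoC 0.
Proof.
  induction n as [|n IH]; intros H.
  - apply sumC_0.
  - rewrite sumC_S, IH, H; [ring | lia |]. intros k Hk; apply H; lia.
Qed.

Lemma sumC_single (u : nat -> C) (n j : nat) :
  (1 <= j <= n)%nat -> (forall k, (1 <= k <= n)%nat -> k <> j -> u k = 0) ->
  sumC u 1 n = u j.
Proof.
  induction n as [|n IH]; intros Hj H; [lia|].
  rewrite sumC_S. destruct (Nat.eq_dec j (S n)) as [->|N].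
  - rewrite sumC_zero; [ring|]. intros k Hk; apply H; lia.
  - rewrite IH, (H (S n)); [ring | lia | lia | lia |].
    intros k Hk; apply H; lia.
Qed.

Lemma sumC_ext (u v : nat -> C) (n : nat) :
  (forall k, (1 <= k <= n)%nat -> u k = v k) -> sumC u 1 n = sumC v 1 n.
Proof. intros H. apply (sum_n_m_ext_loc (G := C_AbelianGroup)). exact H. Qed.

Lemma poly_lead_sum (m : nat) (l : C) (q : nat -> C -> C) (u : nat -> C) (n : nat) :
  (forall k, (1 <= k <= n)%nat -> poly_lead m l (q k)) ->
  exists l', poly_lead m l' (fun z => sumC (fun k => u k * q k z) 1 n).
Proof.
  induction n as [|n IH]; intros H.
  - destruct (poly_lead_le 0 m 0 (fun _ => 0)) as [l' Hl]; [lia | easy |].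
    exists l'. refine (poly_lead_ext _ _ _ _ _ Hl). intros z. now rewrite sumC_0.
  - destruct IH as [l' Hl]. { intros k Hk; apply H; lia. }
    exists (1 * l' + u (S n) * l).
    refine (poly_lead_ext _ _ _ _ _
      (poly_lead_combine m l' l 1 (u (S n)) _ _ Hl (H (S n) ltac:(lia)))).
    intros z. rewrite sumC_S. ring.
Qed.

(** * Exactness of the Gauss rule with n + 1 nodes *)

Section Quadrature.

Variables (n : nat) (p : C -> C) (t : nat -> C).
Hypothesis Hp : poly_lead (S n) 1 p.
Hypothesis Hroot : forall k, (1 <= k <= S n)%nat -> p (t k) = 0.
Hypothesis Hdist : forall j k, (1 <= j <= S n)%nat -> (1 <= k <= S n)%nat ->
  t j = t k -> j = k.

(** The quotient p / (z - t k) vanishes at all other nodes. If it vanished at t k too, a polynomial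
    of degree n with top coefficient 1 would have n + 1 distinct zeros. *)
Lemma node_factors : exists q : nat -> C -> C, forall k, (1 <= k <= S n)%nat ->
  poly_lead n 1 (q k) /\ (forall z, p z = (z - t k) * q k z) /\ q k (t k) <> 0 /\
  forall j, (1 <= j <= S n)%nat -> j <> k -> q k (t j) = 0.
Proof.
  apply (functional_choice (fun k q => (1 <= k <= S n)%nat ->
    poly_lead n 1 q /\ (forall z, p z = (z - t k) * q z) /\ q (t k) <> 0 /\
    forall j, (1 <= j <= S n)%nat -> j <> k -> q (t j) = 0)).
  intros k.
  destruct (poly_lead_divide n 1 (t k) p Hp) as [q [H1 H2]].
  exists q. intros Hk. rewrite Hroot in H2 by easy.
  assert (H2' : forall z, p z = (z - t k) * q z) by (intros z; rewrite H2; ring).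
  assert (Z : forall j, (1 <= j <= S n)%nat -> j <> k -> q (t j) = 0).
  { intros j Hj Hjk.
    assert (N : t j - t k <> 0).
    { apply Cminus_eq_contra. intros E. apply Hdist in E; lia. }
    replace (q (t j)) with (/ (t j - t k) * ((t j - t k) * q (t j))) by (field; exact N).
    rewrite <- H2', Hroot by easy. ring. }
  repeat split; try easy.
  intros K.
  destruct (poly_lead_vanish n 1 q t H1 Hdist) as [A _]; [|now apply C1_nz].
  intros j Hj. destruct (Nat.eq_dec j k) as [->|N]; [easy | now apply Z].
Qed.

(** The difference of both sides has degree at most n and vanishes at n + 1 distinct nodes. *)
Lemma lagrange_interpolation (q : nat -> C -> C) :
  (forall k, (1 <= k <= S n)%nat ->
    poly_lead n 1 (q k) /\ q k (t k) <> 0 /\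
    forall j, (1 <= j <= S n)%nat -> j <> k -> q k (t j) = 0) ->
  forall (l : C) (g : C -> C), poly_lead n l g ->
  forall z, g z = sumC (fun k => g (t k) * (q k z / q k (t k))) 1 (S n).
Proof.
  intros Hq l g Hg z.
  destruct (poly_lead_sum n 1 q (fun k => g (t k) / q k (t k)) (S n)) as [l' Hl].
  { intros k Hk; now apply Hq. }
  pose proof (poly_lead_combine n _ _ 1 (-1) _ _ Hg Hl) as D.
  destruct (poly_lead_vanish n _ _ t D Hdist) as [_ V].
  - intros j Hj. destruct (Hq j Hj) as [_ [N _]].
    rewrite (sumC_single _ (S n) j Hj).
    + field. exact N.
    + intros k Hk Hkj. destruct (Hq k Hk) as [_ [_ Z]].
      rewrite (Z j) by (try easy; now apply not_eq_sym). ring.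
  - specialize (V z). cbn beta in V.
    rewrite (sumC_ext _ (fun k => g (t k) / q k (t k) * q k z)).
    + apply Ceq_minus. rewrite <- V. ring.
    + intros k _. unfold Cdiv. ring.
Qed.

(* [J g v] reads "the integral of [g] exists and equals [v]"; only linearity
   of the integral matters. *)
Variable J : (C -> C) -> C -> Prop.
Hypothesis J_ext : forall g g' v, (forall z, g z = g' z) -> J g v -> J g' v.
Hypothesis J_lin : forall a b g g' v v', J g v -> J g' v' ->
  J (fun z => a * g z + b * g' z) (a * v + b * v').
Hypothesis J_0 : J (fun _ => 0) 0.
Variable w : nat -> C.
Variable q : nat -> C -> C.
Hypothesis Hq : forall k, (1 <= k <= S n)%nat ->
  poly_lead n 1 (q k) /\ (forall z, p z = (z - t k) * q k z) /\ q k (t k) <> 0 /\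
  forall j, (1 <= j <= S n)%nat -> j <> k -> q k (t j) = 0.
Hypothesis Hw : forall k, (1 <= k <= S n)%nat -> J (fun z => q k z / q k (t k)) (w k).
Hypothesis Horth : forall k, (k < S n)%nat -> J (fun z => p z * z ^ k) 0.

Lemma J_sum (u : nat -> C) (m : nat) : (m <= S n)%nat ->
  J (fun z => sumC (fun k => u k * (q k z / q k (t k))) 1 m)
    (sumC (fun k => w k * u k) 1 m).
Proof.
  induction m as [|m IH]; intros Hm.
  - rewrite sumC_0. refine (J_ext _ _ _ _ J_0). intros z. now rewrite sumC_0.
  - rewrite sumC_S.
    replace (sumC (fun k => w k * u k) 1 m + w (S m) * u (S m)) with
      (1 * sumC (fun k => w k * u k) 1 m + u (S m) * w (S m)) by ring.
    refine (J_ext _ _ _ _ (J_lin 1 (u (S m)) _ _ _ _ (IH ltac:(lia)) (Hw (S m) ltac:(lia)))).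
    intros z. rewrite sumC_S. ring.
Qed.

(** Induction on the excess k of the degree over n. Subtracting l p(z) z^k removes the top
    coefficient and changes neither side: its integral is 0 by orthogonality, and it vanishes at
    every node. Interpolation settles k = 0. *)
Lemma quadrature_exact_step (k : nat) : (k <= S n)%nat ->
  forall (l : C) (g : C -> C), poly_lead (n + k) l g ->
  J g (sumC (fun i => w i * g (t i)) 1 (S n)).
Proof.
  induction k as [|k IH]; intros Hk l g Hg.
  - rewrite Nat.add_0_r in Hg.
    refine (J_ext _ _ _ _ (J_sum (fun k => g (t k)) (S n) (le_n _))).
    intros z. symmetry. refine (lagrange_interpolation q _ l g Hg z).
    intros i Hi. destruct (Hq i Hi) as [A [_ [B D]]]. now repeat split.
  - rewrite Nat.add_succ_r in Hg.
    pose proof (poly_lead_shift _ k _ _ Hp) as P.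
    pose proof (poly_lead_combine _ _ _ 1 (- l) _ _ Hg P) as D.
    replace (1 * l + - l * 1) with (RtoC 0) in D by ring.
    destruct (poly_lead_zero _ _ D) as [l' D'].
    pose proof (J_lin 1 l _ _ _ _ (IH ltac:(lia) l' _ D') (Horth k ltac:(lia))) as E.
    replace (sumC (fun i => w i * g (t i)) 1 (S n)) with
      (1 * sumC (fun i => w i * (1 * g (t i) + - l * (p (t i) * t i ^ k))) 1 (S n) + l * 0).
    + refine (J_ext _ _ _ _ E). intros z. ring.
    + rewrite (sumC_ext _ (fun i => w i * g (t i))); [ring|].
      intros i Hi. rewrite Hroot by easy. ring.
Qed.

Lemma quadrature_exact (j : nat) : (j < 2 * S n)%nat ->
  J (fun z => z ^ j) (sumC (fun i => w i * t i ^ j) 1 (S n)).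
Proof.
  intros Hj.
  destruct (poly_lead_le j (n + S n) 1 (fun z => z ^ j)) as [l Hl]; [lia | apply poly_lead_pow |].
  exact (quadrature_exact_step (S n) (le_n _) l _ Hl).
Qed.

End Quadrature.

(** * Taylor expansion *)

(** N counts terms, so the degree is below N and the remainder has order z^N. *)
Fixpoint psum (N : nat) (a : nat -> C) (z : C) : C :=
  match N with
  | O => 0
  | S k => psum k a z + a k * z ^ k
  end.

Lemma psum_sum_n (a : nat -> C) (z : C) (n : nat) :
  sum_n (G := C_NormedModule) (fun k => scal (V := C_NormedModule) (pow_n (K := C_AbsRing) z k) (a k)) n
  = psum (S n) a z.
Proof.
  induction n as [|n IH].
  - rewrite sum_O. cbn. change (1 * a 0%nat = 0 + a 0%nat * 1). ring.
  - rewrite sum_Sn, IH.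
    change (psum (S n) a z + z ^ S n * a (S n) = psum (S n) a z + a (S n) * z ^ S n). ring.
Qed.

Lemma is_pseries_psum (a : nat -> C) (z l : C) :
  is_pseries (K := C_AbsRing) (V := C_NormedModule) a z l ->
  forall eps, (0 < eps)%R -> exists n0, forall n, (n0 <= n)%nat -> (Cmod (psum n a z - l) < eps)%R.
Proof.
  intros H eps He.
  destruct (filterlim_Cmod eventually _ _ l H eps He) as [n0 Hn].
  exists (S n0). intros n Hn0. destruct n as [|n]; [lia|].
  specialize (Hn n ltac:(lia)). now rewrite psum_sum_n in Hn.
Qed.

(** The terms are at most B q^k with q = |h| / x <= 1/2; 2 - 2 (1/2)^m is the m-term geometric sum,
    kept exact so that the induction closes. *)
Lemma psum_tail_geometric (a : nat -> C) (x B : R) (h : C) (N m : nat) :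
  (0 < x)%R -> (forall k, (Cmod (a k) * x ^ k <= B)%R) -> (Cmod h <= x / 2)%R ->
  (Cmod (psum (N + m) a h - psum N a h) <= B * (Cmod h / x) ^ N * (2 - 2 * (1 / 2) ^ m))%R.
Proof.
  intros Hx HB Hh.
  set (q := (Cmod h / x)%R).
  assert (Hq : (0 <= q <= 1 / 2)%R).
  { unfold q; split.
    - apply Rcomplements.Rdiv_le_0_compat; [apply Cmod_ge_0 | easy].
    - apply Rmult_le_reg_r with x; [easy|]. field_simplify; lra. }
  induction m as [|m IH].
  - rewrite Nat.add_0_r. replace (psum N a h - psum N a h) with (RtoC 0) by ring.
    rewrite Cmod_0. simpl. lra.
  - rewrite Nat.add_succ_r. cbn [psum].
    replace (psum (N + m) a h + a (N + m)%nat * h ^ (N + m) - psum N a h) with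
      ((psum (N + m) a h - psum N a h) + a (N + m)%nat * h ^ (N + m)) by ring.
    eapply Rle_trans; [apply Cmod_triangle|].
    rewrite Cmod_mult, Cmod_pow.
    assert (T : (Cmod (a (N + m)%nat) * Cmod h ^ (N + m) <= B * q ^ N * (1 / 2) ^ m)%R).
    { replace (Cmod h) with (x * q)%R by (unfold q; field; lra).
      rewrite Rpow_mult_distr, <- Rmult_assoc, (pow_add q), <- Rmult_assoc.
      specialize (HB (N + m)%nat).
      assert (P1 : (0 <= q ^ N)%R) by (apply pow_le; lra).
      assert (P2 : (0 <= q ^ m <= (1 / 2) ^ m)%R)
        by (split; [apply pow_le; lra | apply pow_incr; lra]).
      assert (0 <= Cmod (a (N + m)%nat) * x ^ (N + m))%R
        by (apply Rmult_le_pos; [apply Cmod_ge_0 | apply pow_le; lra]).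
      apply Rmult_le_compat; try easy; try apply Rmult_le_pos; try easy.
      now apply Rmult_le_compat_r. }
    simpl pow. lra.
Qed.

(** Convergence at the single point x = rho / 2 bounds |a k| x^k. For |h| <= rho / 4 = x / 2 the
    tail is then dominated by a geometric series of ratio at most 1/2. *)
Lemma taylor_remainder (a : nat -> C) (F : C -> C) (rho : R) (N : nat) :
  (0 < rho)%R ->
  (forall h, (Cmod h < rho)%R ->
    is_pseries (K := C_AbsRing) (V := C_NormedModule) a h (F h)) ->
  exists M, (0 <= M)%R /\
  forall h, (Cmod h <= rho / 4)%R -> (Cmod (F h - psum N a h) <= M * Cmod h ^ N)%R.
Proof.
  intros Hr HF.
  set (x := (rho / 2)%R).
  assert (Hx : (0 < x)%R) by (unfold x; lra).
  assert (HB : exists B, forall k, (Cmod (a k) * x ^ k <= B)%R).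
  { assert (Cx : (Cmod (RtoC x) < rho)%R).
    { rewrite Cmod_R, Rabs_pos_eq; unfold x; lra. }
    destruct (is_pseries_psum a x (F x) (HF _ Cx) 1 Rlt_0_1) as [n0 Hn0].
    assert (E : forall k, (Cmod (a k) * x ^ k = Cmod (psum (S k) a x - psum k a x))%R).
    { intros k. cbn [psum].
      replace (psum k a x + a k * x ^ k - psum k a x) with (a k * x ^ k) by ring.
      rewrite Cmod_mult, Cmod_pow, Cmod_R, (Rabs_pos_eq x) by lra. easy. }
    assert (fin : forall m, exists B, forall k, (k < m)%nat -> (Cmod (a k) * x ^ k <= B)%R).
    { induction m as [|m [B IH]].
      - exists 0%R. lia.
      - exists (Rmax B (Cmod (a m) * x ^ m)). intros k Hk.
        destruct (Nat.eq_dec k m) as [->|Hkm]; [apply Rmax_r|].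
        eapply Rle_trans; [apply IH; lia | apply Rmax_l]. }
    (* From n0 on, consecutive partial sums lie within 1 of the limit, so a term, being their
       difference, is at most 2. *)
    destruct (fin n0) as [B HB].
    exists (Rmax B 2). intros k.
    destruct (Nat.lt_ge_cases k n0) as [Hk|Hk].
    - eapply Rle_trans; [apply HB; lia | apply Rmax_l].
    - eapply Rle_trans; [|apply Rmax_r]. rewrite E.
      replace (psum (S k) a x - psum k a x) with
        ((psum (S k) a x - F x) + - (psum k a x - F x)) by ring.
      eapply Rle_trans; [apply Cmod_triangle|]. rewrite Cmod_opp.
      pose proof (Hn0 k Hk). pose proof (Hn0 (S k) ltac:(lia)). lra. }
  destruct HB as [B HB].
  assert (B0 : (0 <= B)%R).
  { eapply Rle_trans; [|apply (HB 0%nat)]. simpl. pose proof (Cmod_ge_0 (a 0%nat)); lra. }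
  assert (xN : (0 < x ^ N)%R) by (now apply pow_lt).
  exists (2 * B / x ^ N)%R. split.
  { apply Rcomplements.Rdiv_le_0_compat; lra. }
  intros h Hh.
  apply le_epsilon. intros eps He.
  destruct (is_pseries_psum a h (F h) (HF h ltac:(lra)) eps He) as [n0 Hn0].
  specialize (Hn0 (N + n0)%nat ltac:(lia)).
  pose proof (psum_tail_geometric a x B h N n0 Hx HB ltac:(unfold x; lra)) as G.
  replace (F h - psum N a h) with
    ((psum (N + n0) a h - psum N a h) + - (psum (N + n0) a h - F h)) by ring.
  eapply Rle_trans; [apply Cmod_triangle|]. rewrite Cmod_opp.
  assert (Q : (0 <= (Cmod h / x) ^ N)%R).
  { apply pow_le, Rcomplements.Rdiv_le_0_compat; [apply Cmod_ge_0 | easy]. }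
  assert (0 < (1 / 2) ^ n0)%R by (apply pow_lt; lra).
  assert (K : (2 * B / x ^ N * Cmod h ^ N = B * (Cmod h / x) ^ N * 2)%R).
  { unfold Rdiv at 2. rewrite Rpow_mult_distr, pow_inv. field. lra. }
  rewrite K.
  assert (0 <= B * (Cmod h / x) ^ N)%R by (now apply Rmult_le_pos).
  nra.
Qed.

(** The Taylor remainder of order 1 at g s is a local Lipschitz estimate. *)
Lemma analytic_continuous (f : C -> C) (r : R) (g : R -> C) (s : R) :
  analytic_in_disk f r -> (Cmod (g s) < r)%R -> continuous (U := CR) g s ->
  continuous (U := CR) (fun s => f (g s)) s.
Proof.
  intros Hf Hs Hg.
  destruct (Hf (g s) Hs) as [a [rho Ha]].
  destruct (taylor_remainder a (fun h => f (g s + h)) rho 1 (cond_pos rho)) as [M [HM HT]].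
  { intros h Hh. specialize (Ha (g s + h)).
    replace (g s + h - g s) with h in Ha by ring. now apply Ha. }
  assert (HT' : forall z, (Cmod (z - g s) <= rho / 4)%R ->
    (Cmod (f z - f (g s)) <= M * Cmod (z - g s))%R).
  { assert (A0 : f (g s) = a 0%nat).
    { pose proof (HT 0) as H0. rewrite Cmod_0 in H0.
      specialize (H0 ltac:(destruct rho; simpl; lra)).
      rewrite Cplus_0_r in H0. simpl in H0. rewrite Rmult_0_l, Rmult_0_r in H0.
      apply Ceq_minus, Cmod_eq_0, Rle_antisym; [|apply Cmod_ge_0].
      eapply Rle_trans; [|exact H0]. right. f_equal. ring. }
    intros z Hz. specialize (HT (z - g s) Hz).
    replace (g s + (z - g s)) with z in HT by ring.
    rewrite A0. simpl in HT. rewrite Rmult_1_r in HT.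
    eapply Rle_trans; [|exact HT]. right. f_equal. ring. }
  apply (filterlim_locally (U := CR)); intros eps.
  (* Dividing by M + 1 covers M = 0. *)
  assert (He : (0 < Rmin (rho / 4) (eps / (M + 1)))%R).
  { apply Rmin_pos; [destruct rho; simpl; lra|].
    apply Rdiv_lt_0_compat; [destruct eps; easy | lra]. }
  generalize (filterlim_Cmod (locally s) _ g (g s) Hg _ He).
  apply filter_imp. intros y HB.
  apply C_NormedModule_mixin_compat1.
  change (minus (f (g y)) (f (g s))) with (f (g y) - f (g s)).
  pose proof (Rmin_l (rho / 4) (eps / (M + 1))). pose proof (Rmin_r (rho / 4) (eps / (M + 1))).
  specialize (HT' (g y) ltac:(lra)).
  pose proof (Cmod_ge_0 (g y - g s)).
  assert (Cmod (g y - g s) * (M + 1) < eps)%R.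
  { replace (pos eps) with (eps / (M + 1) * (M + 1))%R by (field; lra).
    apply Rmult_lt_compat_r; lra. }
  nra.
Qed.

(** Moves the factor 1 / L into the coefficients, so that exactness in the unscaled variable
    applies. *)
Lemma psum_scale (N : nat) (a : nat -> C) (z c : C) :
  psum N a (z * c) = psum N (fun j => a j * c ^ j) z.
Proof.
  induction N as [|N IH]; [easy|]. cbn [psum]. rewrite IH, Cpow_mult_l. ring.
Qed.

Lemma psum_continuous (N : nat) (a : nat -> C) (g : R -> C) (x : R) :
  continuous (U := CR) g x -> continuous (U := CR) (fun s => psum N a (g s)) x.
Proof.
  intros Hg. induction N as [|N IH].
  - apply continuous_const.
  - apply continuous_Cplus; [exact IH|].
    apply continuous_Cmult; [apply continuous_const|].
    exact (poly_lead_continuous N 1 (fun z => z ^ N) g x (poly_lead_pow N) Hg).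
Qed.

(** * The integrand on the rays *)

Ltac C_components :=
  apply injective_projections; unfold Cminus, Cmult, Cplus, Copp, RtoC, Ci; cbn [fst snd].

(** This is exp(a s^3 + (b + i b') s), the common form of oscillator and Gauss weight on both rays;
    the family is closed under products and under scaling of s. *)
Definition cubic_exp (a b b' s : R) : C :=
  (exp (a * s ^ 3 + b * s) * cos (b' * s), exp (a * s ^ 3 + b * s) * sin (b' * s))%R.

Lemma Cmod_polar (r t : R) : (0 <= r)%R -> Cmod (r * cos t, r * sin t)%R = r.
Proof.
  intros Hr. unfold Cmod; cbn [fst snd].
  replace ((r * cos t) ^ 2 + (r * sin t) ^ 2)%R with (r ^ 2)%R.
  - now apply sqrt_pow2.
  - pose proof (sin2_cos2 t) as E. unfold Rsqr in E.
    replace ((r * cos t) ^ 2 + (r * sin t) ^ 2)%R with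
      (r ^ 2 * (sin t * sin t + cos t * cos t))%R by ring.
    rewrite E. ring.
Qed.

Lemma Cmod_cubic_exp (a b b' s : R) :
  Cmod (cubic_exp a b b' s) = exp (a * s ^ 3 + b * s).
Proof. apply Cmod_polar. left; apply exp_pos. Qed.

Lemma cubic_exp_mult (a1 b1 c1 a2 b2 c2 s : R) :
  cubic_exp a1 b1 c1 s * cubic_exp a2 b2 c2 s = cubic_exp (a1 + a2) (b1 + b2) (c1 + c2) s.
Proof.
  unfold cubic_exp.
  replace ((a1 + a2) * s ^ 3 + (b1 + b2) * s)%R with
    ((a1 * s ^ 3 + b1 * s) + (a2 * s ^ 3 + b2 * s))%R by ring.
  rewrite (exp_plus (a1 * s ^ 3 + b1 * s)), (Rmult_plus_distr_r c1 c2), cos_plus, sin_plus.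
  C_components; ring.
Qed.

Lemma cubic_exp_scale (a b c L s : R) :
  cubic_exp a b c (L * s) = cubic_exp (a * L ^ 3) (b * L) (c * L) s.
Proof.
  unfold cubic_exp.
  replace (a * (L * s) ^ 3 + b * (L * s))%R with (a * L ^ 3 * s ^ 3 + b * L * s)%R by ring.
  now replace (c * (L * s))%R with (c * L * s)%R by ring.
Qed.

Lemma is_derive_cubic_exp (a b b' s : R) :
  is_derive (V := CR) (cubic_exp a b b') s
    (cubic_exp a b b' s * (3 * a * s ^ 2 + b, b')%R).
Proof.
  apply is_derive_pair; unfold cubic_exp, Cmult; cbn [fst snd].
  - auto_derive; [trivial | cbn [pow]; ring].
  - auto_derive; [trivial | cbn [pow]; ring].
Qed.

Lemma continuous_cubic_exp (a b b' s : R) : continuous (U := CR) (cubic_exp a b b') s.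
Proof.
  apply (ex_derive_continuous (V := CR)). eexists. apply is_derive_cubic_exp.
Qed.

Lemma Cexp_Ci (theta : R) : Cexp (Ci * RtoC theta) = (cos theta, sin theta).
Proof.
  unfold Cexp. replace (Re (Ci * RtoC theta)) with 0%R by (cbn; ring).
  replace (Im (Ci * RtoC theta)) with theta by (cbn; ring).
  rewrite exp_0. ring.
Qed.

(* The rays arg z = pi/6 and arg z = 5 pi/6 are spanned by x + i/2 with
   x = sqrt 3 / 2 and x = - sqrt 3 / 2. On both of them z^3 = i |z|^3, which
   turns the oscillation into decay. *)
Lemma oscillator_on_ray (omega c x s : R) : (x ^ 2 = 3 / 4)%R ->
  oscillator omega c (RtoC s * (x, 1 / 2)%R) =
  cubic_exp (- omega / 3) (omega * c / 2) (- (omega * c * x)) s.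
Proof.
  intros Hx. unfold oscillator, Cexp.
  assert (E : Ci * RtoC omega * ((RtoC s * (x, 1 / 2)%R) ^ 3 / RtoC 3 - RtoC c * (RtoC s * (x, 1 / 2)%R))
    = (- omega / 3 * s ^ 3 + omega * c / 2 * s, - (omega * c * x) * s)%R).
  { replace ((RtoC s * (x, 1 / 2)%R) ^ 3) with (RtoC (s ^ 3) * Ci).
    - unfold Cdiv. rewrite <- RtoC_inv by lra.
      C_components; field.
    - rewrite Cpow_mult_l, RtoC_pow. f_equal. rewrite !Cpow_S.
      change ((x, 1 / 2)%R ^ 0) with (1%R, 0%R).
      assert (X3 : (x * (x * x) = 3 / 4 * x)%R) by (rewrite <- Hx; ring).
      C_components; nra. }
  rewrite E. unfold Re, Im; cbn [fst snd]. unfold cubic_exp.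
  C_components; ring.
Qed.

Lemma gauss_weight_on_ray (delta x s : R) : (x ^ 2 = 3 / 4)%R ->
  gauss_weight delta (RtoC s * (x, 1 / 2)%R) =
  cubic_exp (- 1 / 3) (delta / 2) (- (delta * x)) s.
Proof.
  intros Hx. replace (gauss_weight delta (RtoC s * (x, 1 / 2)%R)) with
    (oscillator 1 delta (RtoC s * (x, 1 / 2)%R)).
  - rewrite oscillator_on_ray by easy. f_equal; field.
  - unfold oscillator, gauss_weight. f_equal. ring.
Qed.

Lemma Cmod_ray (x s : R) : (x ^ 2 = 3 / 4)%R -> Cmod (RtoC s * (x, 1 / 2)%R) = Rabs s.
Proof.
  intros Hx. rewrite Cmod_mult, Cmod_R. unfold Cmod at 1; cbn [fst snd].
  rewrite Hx. replace (3 / 4 + (1 / 2) ^ 2)%R with 1%R by field.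
  rewrite sqrt_1. ring.
Qed.

Lemma continuous_ray (e : C) (s : R) : continuous (U := CR) (fun s => RtoC s * e) s.
Proof.
  apply continuous_Cmult; [|apply continuous_const].
  apply continuous_pair; cbn; [apply continuous_id | apply continuous_const].
Qed.

(** * Growth and decay bounds *)

Lemma pow_exp (y : R) (m : nat) : (exp y ^ m = exp (INR m * y))%R.
Proof.
  induction m as [|m IH].
  - simpl. now rewrite Rmult_0_l, exp_0.
  - rewrite S_INR. simpl pow. rewrite IH, <- exp_plus. f_equal. ring.
Qed.

(** By (1 + s)^m <= exp(m s), the power, the linear term and the wanted exp(-s) together cost at
    most exp(A s) with A = |b| + m + 1. Beyond s0 = 1 + A / kappa both s >= 1 and kappa s >= A, so
    the cubic term outweighs A s; before s0, A s <= A s0. *)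
Lemma cubic_decay (kappa b : R) (m : nat) : (0 < kappa)%R ->
  exists K, (0 <= K)%R /\ forall s, (0 <= s)%R ->
  ((1 + s) ^ m * exp (- kappa * s ^ 3 + b * s) <= K * exp (- s))%R.
Proof.
  intros Hk.
  set (A := (Rabs b + INR m + 1)%R).
  assert (HA : (1 <= A)%R).
  { unfold A. pose proof (Rabs_pos b). pose proof (pos_INR m). lra. }
  set (s0 := (1 + A / kappa)%R).
  assert (Hs0 : (0 <= A / kappa)%R) by (apply Rcomplements.Rdiv_le_0_compat; lra).
  exists (exp (A * s0)). split; [left; apply exp_pos|].
  intros s Hs.
  assert (P : ((1 + s) ^ m <= exp (INR m * s))%R).
  { rewrite <- pow_exp. apply pow_incr. split; [lra | apply exp_ineq1_le]. }
  eapply Rle_trans.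
  { apply Rmult_le_compat_r; [left; apply exp_pos | exact P]. }
  rewrite <- !exp_plus.
  assert (B : (b * s <= Rabs b * s)%R).
  { apply Rmult_le_compat_r; [easy | apply Rle_abs]. }
  assert (C : (A * s - kappa * s ^ 3 <= A * s0)%R).
  { destruct (Rle_lt_dec s s0) as [H|H].
    - assert (0 <= kappa * s ^ 3)%R by (apply Rmult_le_pos; [lra | now apply pow_le]).
      nra.
    - assert (A <= kappa * s)%R.
      { replace A with (kappa * (A / kappa))%R by (field; lra).
        apply Rmult_le_compat_l; [lra|]. unfold s0 in H. lra. }
      assert (1 <= s)%R by (unfold s0 in H; lra).
      assert (A * s <= kappa * s * s)%R by (apply Rmult_le_compat_r; lra).
      assert (kappa * s * s <= kappa * s ^ 3)%R.
      { replace (kappa * s ^ 3)%R with (kappa * s * s * s)%R by ring.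
        rewrite <- (Rmult_1_r (kappa * s * s)) at 1.
        apply Rmult_le_compat_l; [|easy]. apply Rmult_le_pos; lra. }
      assert (0 <= A * s0)%R by (apply Rmult_le_pos; unfold s0; lra).
      lra. }
  assert (D : (INR m * s + (- kappa * s ^ 3 + b * s) <= A * s0 + - s)%R).
  { unfold A in C at 1. lra. }
  destruct D as [D|D]; [left; now apply exp_increasing | right; now rewrite D].
Qed.

(** exp y = exp(y / k)^k >= (y / k)^k with y = rho L; taking k = m + 1 keeps k positive when m =
    0. *)
Lemma exp_decay (rho : R) (m : nat) : (0 < rho)%R ->
  exists K, (0 <= K)%R /\ forall L, (1 <= L)%R -> (exp (- (rho * L)) <= K / L ^ m)%R.
Proof.
  intros Hr.
  set (k := INR (S m)).
  assert (Hk : (0 < k)%R) by (apply lt_0_INR; lia).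
  exists ((k / rho) ^ S m)%R. split.
  { apply pow_le, Rcomplements.Rdiv_le_0_compat; lra. }
  intros L HL.
  assert (E : (exp (rho * L) = exp (rho * L / k) ^ S m)%R).
  { rewrite pow_exp. f_equal. fold k. field. lra. }
  assert (P : ((rho * L / k) ^ S m <= exp (rho * L))%R).
  { rewrite E. apply pow_incr. split.
    - apply Rcomplements.Rdiv_le_0_compat; [nra | easy].
    - pose proof (exp_ineq1_le (rho * L / k)). lra. }
  rewrite exp_Ropp.
  assert (LS : (L ^ m <= L ^ S m)%R) by (apply Rle_pow; [easy | lia]).
  assert (Lm : (0 < L ^ m)%R) by (apply pow_lt; lra).
  assert (Q : (L ^ S m = (k / rho) ^ S m * (rho * L / k) ^ S m)%R).
  { rewrite <- Rpow_mult_distr. f_equal. field. lra. }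
  assert (Kp : (0 < (k / rho) ^ S m)%R) by (apply pow_lt, Rdiv_lt_0_compat; lra).
  pose proof (exp_pos (rho * L)) as Ep.
  apply Rmult_le_reg_r with (exp (rho * L) * L ^ m)%R; [now apply Rmult_lt_0_compat|].
  replace (/ exp (rho * L) * (exp (rho * L) * L ^ m))%R with (L ^ m)%R by (field; lra).
  replace ((k / rho) ^ S m / L ^ m * (exp (rho * L) * L ^ m))%R
    with ((k / rho) ^ S m * exp (rho * L))%R by (field; lra).
  eapply Rle_trans; [exact LS|]. rewrite Q.
  apply Rmult_le_compat_l; [lra | exact P].
Qed.

Lemma poly_lead_growth (m : nat) : forall (l : C) (q : C -> C), poly_lead m l q ->
  exists A, (0 <= A)%R /\ forall z, (Cmod (q z) <= A * (1 + Cmod z) ^ m)%R.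
Proof.
  induction m as [|m IH]; intros l q H.
  - exists (Cmod l). split; [apply Cmod_ge_0|]. intros z. cbn in H. rewrite H. simpl. lra.
  - destruct H as [c [q1 [H1 H2]]]. destruct (IH l q1 H1) as [A [HA H]].
    pose proof (Cmod_ge_0 c).
    exists (Cmod c + A)%R. split; [lra|]. intros z. rewrite H2.
    eapply Rle_trans; [apply Cmod_triangle|]. rewrite Cmod_mult.
    specialize (H z). pose proof (Cmod_ge_0 z).
    assert (1 <= (1 + Cmod z) ^ S m)%R by (apply pow_R1_Rle; lra).
    assert (P : (0 <= (1 + Cmod z) ^ m)%R) by (apply pow_le; lra).
    assert (Cmod z * Cmod (q1 z) <= (1 + Cmod z) * (A * (1 + Cmod z) ^ m))%R.
    { apply Rmult_le_compat; try lra. apply Cmod_ge_0. }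
    simpl pow in *. nra.
Qed.

Lemma psum_growth (N : nat) (a : nat -> C) :
  exists A, (0 <= A)%R /\ forall z, (Cmod (psum N a z) <= A * (1 + Cmod z) ^ N)%R.
Proof.
  induction N as [|N [A [HA H]]].
  - exists 0%R. split; [lra|]. intros z. simpl. rewrite Cmod_0. lra.
  - pose proof (Cmod_ge_0 (a N)).
    exists (A + Cmod (a N))%R. split; [lra|]. intros z. cbn [psum].
    eapply Rle_trans; [apply Cmod_triangle|]. rewrite Cmod_mult, Cmod_pow.
    specialize (H z). pose proof (Cmod_ge_0 z).
    assert (P : (0 <= (1 + Cmod z) ^ N)%R) by (apply pow_le; lra).
    assert ((1 + Cmod z) ^ N <= (1 + Cmod z) ^ S N)%R by (apply Rle_pow; [lra | lia]).
    assert (Cmod z ^ N <= (1 + Cmod z) ^ N)%R by (apply pow_incr; lra).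
    nra.
Qed.

(* Convergence of the integral makes the antiderivative of [g] bounded, so
   integration by parts requires bounds only for [h] and its derivative; [g]
   itself may be unbounded near [r]. *)
Lemma improper_tail_bound (g : R -> C) (r : R) (l : C) :
  (0 < r)%R -> (forall s, (0 <= s < r)%R -> continuous (U := CR) g s) ->
  is_RInt_gen (V := CR) g (at_point 0%R) (at_left r) l ->
  exists M, (0 <= M)%R /\
  forall (h dh : R -> C) (A B rho y : R) (I : C),
    (forall s, is_derive (V := CR) h s (dh s)) ->
    (forall s, continuous (U := CR) dh s) ->
    (0 < rho)%R -> (rho <= y < r)%R ->
    (forall s, (rho <= s <= y)%R -> (Cmod (h s) <= A)%R) ->
    (forall s, (rho <= s <= y)%R -> (Cmod (dh s) <= B)%R) ->
    is_RInt (V := CR) (fun s => g s * h s) rho y I ->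
    (Cmod I <= M * (2 * A + r * B))%R.
Proof.
  intros Hr Hg Hl.
  set (H := fun y => RInt (V := C_R_CompleteNormedModule) g 0 y).
  assert (HH : forall y, (0 <= y < r)%R -> is_RInt (V := CR) g 0 y (H y)).
  { intros y Hy. apply (RInt_correct (V := C_R_CompleteNormedModule)).
    apply (ex_RInt_continuous (V := C_R_CompleteNormedModule)).
    intros s Hs. rewrite Rmin_left, Rmax_right in Hs by lra. apply Hg; lra. }
  assert (HM : exists M, (0 <= M)%R /\ forall y, (0 <= y < r)%R -> (Cmod (H y) <= M)%R).
  { pose proof (proj1 (is_RInt_gen_Cmod (at_left r) _ g 0 l) Hl 1%R Rlt_0_1) as [d Hd].
    (* Beyond b the antiderivative is within 1 of l; on [0, b] the integrand is bounded by
       continuity. *)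
    set (b := (Rmax 0 (r - d / 2))%R).
    assert (Hb : (0 <= b < r)%R).
    { unfold b. split; [apply Rmax_l|]. apply Rmax_lub_lt; [easy|]. destruct d; simpl; lra. }
    destruct (bounded_continuity (V := CR) g 0 b) as [Mg HMg].
    { intros s Hs. apply Hg; lra. }
    exists (Rmax (Cmod l + 1) (r * Rmax 0 Mg)). split.
    { eapply Rle_trans; [|apply Rmax_l]. pose proof (Cmod_ge_0 l); lra. }
    intros y Hy. destruct (Rle_lt_dec y b) as [Hyb|Hyb].
    - eapply Rle_trans; [|apply Rmax_r].
      apply Rle_trans with ((y - 0) * Rmax 0 Mg)%R.
      + rewrite Cmod_norm. apply (norm_RInt_le_const (V := CR) g 0 y); [lra | | apply HH; lra].
        intros s Hs. eapply Rle_trans; [|apply Rmax_r]. left. apply HMg. lra.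
      + apply Rmult_le_compat_r; [apply Rmax_l | lra].
    - eapply Rle_trans; [|apply Rmax_l].
      destruct (Hd y) as [I [HI HB]].
      + apply Rabs_def1; unfold minus, plus, opp; cbn.
        * destruct d; simpl in *; lra.
        * pose proof (Rmax_r 0 (r - d / 2)) as Hbd. fold b in Hbd. destruct d; simpl in *; lra.
      + lra.
      + replace (H y) with ((I - l) + l).
        { eapply Rle_trans; [apply Cmod_triangle|]. lra. }
        rewrite <- (is_RInt_unique (V := C_R_CompleteNormedModule) g 0 y I HI).
        unfold H. ring. }
  destruct HM as [M [M0 HM]].
  exists M. split; [easy|].
  intros h dh A B rho y I Hh Hdh Hrho Hy HA HB HI.
  assert (DH : forall s, (0 < s < r)%R -> is_derive (V := CR) H s (g s)).
  { intros s Hs. apply (is_derive_RInt (V := CR) g H 0 s); [|apply Hg; lra].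
    assert (Hd : (0 < Rmin s (r - s))%R) by (apply Rmin_pos; lra).
    exists (mkposreal _ Hd). intros u Hu. apply HH.
    unfold ball in Hu; cbn in Hu. unfold AbsRing_ball, abs, minus, plus, opp in Hu; cbn in Hu.
    apply Rabs_def2 in Hu.
    pose proof (Rmin_l s (r - s)). pose proof (Rmin_r s (r - s)). lra. }
  assert (mm : forall s, (Rmin rho y <= s <= Rmax rho y)%R -> (0 < s < r)%R /\ (rho <= s <= y)%R).
  { intros s Hs. rewrite Rmin_left, Rmax_right in Hs by lra. lra. }
  assert (CH : forall s, (0 < s < r)%R -> continuous (U := CR) H s).
  { intros s Hs. apply (ex_derive_continuous (V := CR)). exists (g s). now apply DH. }
  assert (Ch : forall s, continuous (U := CR) h s).
  { intros s. apply (ex_derive_continuous (V := CR)). exists (dh s). apply Hh. }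
  (* Integration by parts: the integrand is the derivative of H h, and only H, not g, is estimated
     afterwards. *)
  assert (P : is_RInt (V := CR) (fun s => g s * h s + H s * dh s) rho y
     (H y * h y - H rho * h rho)).
  { apply (is_RInt_derive (V := C_R_CompleteNormedModule) (fun s => H s * h s)).
    - intros s Hs. apply is_derive_Cmult; [apply DH; now apply mm | apply Hh].
    - intros s Hs. apply continuous_Cplus; apply continuous_Cmult.
      + apply Hg. apply mm in Hs. lra.
      + apply Ch.
      + apply CH. now apply mm.
      + apply Hdh. }
  pose proof (is_RInt_minus (V := CR) _ _ _ _ _ _ P HI) as Q.
  assert (Q' : is_RInt (V := CR) (fun s => H s * dh s) rho y (H y * h y - H rho * h rho - I)).
  { refine (is_RInt_ext (V := CR) _ _ _ _ _ _ Q). intros s _.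
    change ((g s * h s + H s * dh s) - g s * h s = H s * dh s). ring. }
  assert (B0 : (0 <= B)%R).
  { eapply Rle_trans; [apply Cmod_ge_0 | apply (HB rho); lra]. }
  assert (A0 : (0 <= A)%R).
  { eapply Rle_trans; [apply Cmod_ge_0 | apply (HA rho); lra]. }
  assert (E1 : (Cmod (H y * h y - H rho * h rho - I) <= r * (M * B))%R).
  { apply Rle_trans with ((y - rho) * (M * B))%R.
    - rewrite Cmod_norm.
      apply (norm_RInt_le_const (V := CR) (fun s => H s * dh s) rho y); [lra | | exact Q'].
      intros s Hs. rewrite <- Cmod_norm, Cmod_mult.
      apply Rmult_le_compat; try apply Cmod_ge_0; [apply HM; lra | now apply HB].
    - apply Rmult_le_compat_r; [now apply Rmult_le_pos | lra]. }
  replace I with (H y * h y - H rho * h rho - (H y * h y - H rho * h rho - I)) by ring.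
  assert (T : forall u v w : C, (Cmod (u - v - w) <= Cmod u + Cmod v + Cmod w)%R).
  { intros u v w. unfold Cminus. eapply Rle_trans; [apply Cmod_triangle|].
    rewrite Cmod_opp. pose proof (Cmod_triangle u (- v)). rewrite Cmod_opp in *. lra. }
  eapply Rle_trans; [apply T|]. rewrite !Cmod_mult.
  assert (E2 : (Cmod (H y) * Cmod (h y) <= M * A)%R).
  { apply Rmult_le_compat; try apply Cmod_ge_0; [apply HM | apply HA]; lra. }
  assert (E3 : (Cmod (H rho) * Cmod (h rho) <= M * A)%R).
  { apply Rmult_le_compat; try apply Cmod_ge_0; [apply HM | apply HA]; lra. }
  lra.
Qed.

Lemma is_RInt_gen_Cunique (F : (R -> Prop) -> Prop) (FF : ProperFilter F) (g : R -> C) (u v : C) :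
  is_RInt_gen (V := CR) g (at_point 0%R) F u ->
  is_RInt_gen (V := CR) g (at_point 0%R) F v -> u = v.
Proof.
  intros Hu Hv.
  assert (PF : ProperFilter' F) by (apply Proper_StrongProper; exact FF).
  rewrite <- (is_RInt_gen_unique (V := C_R_CompleteNormedModule) g u Hu).
  now apply (is_RInt_gen_unique (V := C_R_CompleteNormedModule) g v).
Qed.

(** * Estimates along one ray *)

Section Ray.

Variables (r : R) (f : C -> C) (delta x : R) (a : nat -> C) (rho : R) (N : nat) (l1 : C).
Hypothesis Hr : (0 < r)%R.
Hypothesis Hf : analytic_in_disk f r.
Hypothesis Hx : (x ^ 2 = 3 / 4)%R.
Hypothesis Hrho : (0 < rho)%R.
Hypothesis Ha : forall h, (Cmod h < rho)%R ->
  is_pseries (K := C_AbsRing) (V := C_NormedModule) a h (f h).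

Let e : C := (x, 1 / 2)%R.
(** The oscillator on the ray for omega = L^3, where omega c = delta L. With [w] below, the Gauss
    weight on the ray, osc L s = w (L s). *)
Let osc (L : R) : R -> C := cubic_exp (- L ^ 3 / 3) (delta * L / 2) (- (delta * L * x)).
Let w : R -> C := cubic_exp (- 1 / 3) (delta / 2) (- (delta * x)).

Lemma e_unit : Cmod e = 1%R.
Proof.
  pose proof (Cmod_ray x 1 Hx) as E. rewrite Cmult_1_l, Rabs_R1 in E. exact E.
Qed.

Lemma ray_integrand_continuous (L s : R) : (0 <= s < r)%R ->
  continuous (U := CR) (fun s => f (RtoC s * e) * osc L s * e) s.
Proof.
  intros Hs.
  apply continuous_Cmult; [|apply continuous_const].
  apply continuous_Cmult; [|apply continuous_cubic_exp].
  apply (analytic_continuous f r (fun s => RtoC s * e) s Hf).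
  - unfold e. rewrite Cmod_ray by easy. rewrite Rabs_pos_eq; lra.
  - apply continuous_ray.
Qed.

(** [improper_tail_bound] fixes its constant from the integrand at L = 1 before the smooth factor is
    chosen, so the bound is uniform in L. *)
Lemma ray_tail :
  is_RInt_gen (V := CR) (fun s => f (RtoC s * e) * osc 1 s * e) (at_point 0%R) (at_left r) l1 ->
  forall r0, (0 < r0 < r)%R ->
  exists M, (0 <= M)%R /\ forall (L : R) (I I0 : C), (1 <= L)%R ->
    is_RInt_gen (V := CR) (fun s => f (RtoC s * e) * osc L s * e) (at_point 0%R) (at_left r) I ->
    is_RInt (V := CR) (fun s => f (RtoC s * e) * osc L s * e) 0 r0 I0 ->
    (Cmod (I - I0) <= M / L ^ S N)%R.
Proof.
  intros H1 r0 Hr0.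
  destruct (improper_tail_bound _ r l1 Hr (ray_integrand_continuous 1) H1) as [M [HM HT]].
  (* The decay rate in L^3 at the inner end r0, where the smooth factor decays slowest. *)
  set (k := (r0 ^ 3 / 3)%R).
  assert (Hk : (0 < k)%R) by (unfold k; assert (0 < r0 ^ 3)%R by (apply pow_lt; lra); lra).
  (* To be applied with L as the variable: S N powers are the target rate, and 3 more absorb the
     factor (1 + L)^3 coming from the derivative of [h]. *)
  destruct (cubic_decay k (Rabs delta * r) (S N + 3) Hk) as [K [HK HD]].
  set (c := (2 + r * (r ^ 2 + Rabs delta))%R).
  assert (Hc : (0 <= c)%R).
  { unfold c. pose proof (Rabs_pos delta). pose proof (pow2_ge_0 r).
    assert (0 <= r * (r ^ 2 + Rabs delta))%R by (apply Rmult_le_pos; lra). lra. }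
  exists (M * exp k * c * K)%R. split.
  { repeat apply Rmult_le_pos; try lra. left; apply exp_pos. }
  intros L I I0 HL HI HI0.
  assert (HLN : (0 < L ^ S N)%R) by (apply pow_lt; lra).
  (* The quotient of [osc L] by [osc 1]: the parameters subtract. *)
  pose (h := cubic_exp (- (L ^ 3 - 1) / 3) (delta * (L - 1) / 2) (- (delta * (L - 1) * x))).
  pose (dh := fun s => h s * (3 * (- (L ^ 3 - 1) / 3) * s ^ 2 + delta * (L - 1) / 2,
                              - (delta * (L - 1) * x))%R).
  (* For s >= r0 the cubic part of the exponent is at most -(L^3 - 1) k = k - k L^3; the linear part
     is at most |delta| r L. *)
  set (A := (exp k * exp (- k * L ^ 3 + Rabs delta * r * L))%R).
  assert (HA0 : (0 < A)%R) by (apply Rmult_lt_0_compat; apply exp_pos).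
  assert (L3 : (1 <= L ^ 3)%R) by (apply pow_R1_Rle; lra).
  assert (HA : forall s, (r0 <= s < r)%R -> (Cmod (h s) <= A)%R).
  { intros s Hs. unfold h, A. rewrite Cmod_cubic_exp, <- exp_plus.
    assert (E1 : ((L ^ 3 - 1) * r0 ^ 3 <= (L ^ 3 - 1) * s ^ 3)%R).
    { apply Rmult_le_compat_l; [lra|]. apply pow_incr; lra. }
    assert (E2 : (delta * (L - 1) / 2 * s <= Rabs delta * r * L)%R).
    { pose proof (Rle_abs delta). pose proof (Rabs_pos delta).
      apply Rle_trans with (Rabs delta * ((L - 1) / 2 * s))%R.
      - replace (delta * (L - 1) / 2 * s)%R with (delta * ((L - 1) / 2 * s))%R by field.
        apply Rmult_le_compat_r; [|easy]. apply Rmult_le_pos; lra.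
      - rewrite Rmult_assoc. apply Rmult_le_compat_l; [easy|]. nra. }
    assert (E : (- (L ^ 3 - 1) / 3 * s ^ 3 + delta * (L - 1) / 2 * s
              <= k + (- k * L ^ 3 + Rabs delta * r * L))%R).
    { unfold k. lra. }
    destruct E as [E|E]; [left; now apply exp_increasing | right; now rewrite E]. }
  assert (HB : forall s, (r0 <= s < r)%R ->
    (Cmod (dh s) <= A * (L ^ 3 * r ^ 2 + Rabs delta * L))%R).
  { intros s Hs. unfold dh. rewrite Cmod_mult.
    apply Rmult_le_compat; try apply Cmod_ge_0; [now apply HA|].
    (* The linear contribution is delta (L - 1) times 1/2 - i x, which has modulus 1. *)
    replace ((3 * (- (L ^ 3 - 1) / 3) * s ^ 2 + delta * (L - 1) / 2, - (delta * (L - 1) * x))%R : C)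
      with (RtoC (- (L ^ 3 - 1) * s ^ 2) + RtoC (delta * (L - 1)) * (1 / 2, - x)%R).
    2: { C_components; field. }
    eapply Rle_trans; [apply Cmod_triangle|].
    rewrite Cmod_mult, !Cmod_R.
    replace (Cmod (1 / 2, - x)%R) with 1%R.
    2: { unfold Cmod; cbn [fst snd]. replace ((- x) ^ 2)%R with (x ^ 2)%R by ring.
         rewrite Hx. replace ((1 / 2) ^ 2 + 3 / 4)%R with 1%R by field. now rewrite sqrt_1. }
    rewrite !Rabs_mult, Rabs_Ropp, (Rabs_pos_eq (L ^ 3 - 1)), (Rabs_pos_eq (L - 1)) by lra.
    rewrite (Rabs_pos_eq (s ^ 2)) by apply pow2_ge_0.
    assert (s ^ 2 <= r ^ 2)%R by (apply pow_incr; lra).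
    pose proof (Rabs_pos delta). pose proof (pow2_ge_0 s).
    assert ((L ^ 3 - 1) * s ^ 2 <= L ^ 3 * r ^ 2)%R by (apply Rmult_le_compat; lra).
    nra. }
  set (B := (A * (L ^ 3 * r ^ 2 + Rabs delta * L))%R) in HB.
  assert (T : forall y Iy, (r0 <= y < r)%R ->
    is_RInt (V := CR) (fun s => f (RtoC s * e) * osc L s * e) 0 y Iy ->
    (Cmod (Iy - I0) <= M * (2 * A + r * B))%R).
  { intros y Iy Hy HIy.
    apply (HT h dh A B r0 y).
    - intros s. apply is_derive_cubic_exp.
    - intros s. apply continuous_Cmult; [apply continuous_cubic_exp|].
      apply continuous_pair; cbn; [|apply continuous_const].
      apply (ex_derive_continuous (V := R_NormedModule)). auto_derive; trivial.
    - lra.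
    - easy.
    - intros s Hs; apply HA; lra.
    - intros s Hs; apply HB; lra.
    - pose proof (is_RInt_Chasles (V := CR) _ _ _ _ _ _ (is_RInt_swap _ _ _ _ HI0) HIy) as Q.
      replace (Iy - I0) with (plus (G := CR) (opp (G := CR) I0) Iy)
        by (change (- I0 + Iy = Iy - I0); ring).
      refine (is_RInt_ext (V := CR) _ _ _ _ _ _ Q).
      intros s _. unfold osc, h.
      replace (cubic_exp (- L ^ 3 / 3) (delta * L / 2) (- (delta * L * x)) s) with
        (cubic_exp (- 1 ^ 3 / 3) (delta * 1 / 2) (- (delta * 1 * x)) s *
         cubic_exp (- (L ^ 3 - 1) / 3) (delta * (L - 1) / 2) (- (delta * (L - 1) * x)) s).
      + match goal with |- ?u = ?v => change (u = v :> C) end. ring.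
      + rewrite cubic_exp_mult. f_equal; field. }
  apply Rle_trans with (M * (2 * A + r * B))%R.
  (* [T] is uniform in y < r, so it survives the limit y -> r. *)
  { apply le_epsilon. intros eps He.
    pose proof (proj1 (is_RInt_gen_Cmod (at_left r) _ _ 0 I) HI eps He) as [d Hd].
    pose (y := Rmax r0 (r - d / 2)%R).
    assert (Hy : (r0 <= y < r)%R).
    { unfold y. split; [apply Rmax_l|]. apply Rmax_lub_lt; [easy|]. destruct d; simpl; lra. }
    assert (Hy2 : (r - d / 2 <= y)%R) by apply Rmax_r.
    destruct (Hd y) as [Iy [HIy HBy]].
    - apply Rabs_def1; unfold minus, plus, opp; cbn; destruct d; simpl in *; lra.
    - lra.
    - replace (I - I0) with ((Iy - I0) + - (Iy - I)) by ring.
      eapply Rle_trans; [apply Cmod_triangle|]. rewrite Cmod_opp.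
      specialize (T y Iy Hy HIy). lra. }
  assert (E : (2 * A + r * B <= c * (1 + L) ^ 3 * A)%R).
  { unfold B, c. pose proof (Rabs_pos delta). pose proof (pow2_ge_0 r).
    assert (P1 : (1 <= (1 + L) ^ 3)%R) by (apply pow_R1_Rle; lra).
    assert (P2 : (L ^ 3 <= (1 + L) ^ 3)%R) by (apply pow_incr; lra).
    assert (P3 : (L <= (1 + L) ^ 3)%R).
    { apply Rle_trans with (1 + L)%R; [lra|].
      rewrite <- (pow_1 (1 + L)) at 1. apply Rle_pow; [lra | lia]. }
    assert (P4 : (L ^ 3 * r ^ 2 + Rabs delta * L <= (r ^ 2 + Rabs delta) * (1 + L) ^ 3)%R).
    { rewrite Rmult_plus_distr_r.
      apply Rplus_le_compat.
      - rewrite Rmult_comm. now apply Rmult_le_compat_l.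
      - now apply Rmult_le_compat_l. }
    assert (P5 : (r * (L ^ 3 * r ^ 2 + Rabs delta * L) <= r * ((r ^ 2 + Rabs delta) * (1 + L) ^ 3))%R)
      by (apply Rmult_le_compat_l; lra).
    replace (2 * A + r * (A * (L ^ 3 * r ^ 2 + Rabs delta * L)))%R with
      ((2 + r * (L ^ 3 * r ^ 2 + Rabs delta * L)) * A)%R by ring.
    apply Rmult_le_compat_r; lra. }
  assert (D : ((1 + L) ^ (S N + 3) * exp (- k * L ^ 3 + Rabs delta * r * L) <= K)%R).
  { eapply Rle_trans; [apply HD; lra|].
    rewrite <- (Rmult_1_r K) at 2. apply Rmult_le_compat_l; [easy|].
    rewrite <- exp_0. left. apply exp_increasing. lra. }
  apply Rmult_le_reg_r with (L ^ S N)%R; [easy|].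
  replace (M * exp k * c * K / L ^ S N * L ^ S N)%R with (M * exp k * c * K)%R by (field; lra).
  apply Rle_trans with (M * (c * (1 + L) ^ 3 * A) * (1 + L) ^ S N)%R.
  - assert (0 <= 2 * A + r * B)%R.
    { unfold B. pose proof (Rabs_pos delta). pose proof (pow2_ge_0 r).
      assert (0 <= L ^ 3 * r ^ 2 + Rabs delta * L)%R by nra.
      assert (0 <= A * (L ^ 3 * r ^ 2 + Rabs delta * L))%R by (apply Rmult_le_pos; lra).
      assert (0 <= r * (A * (L ^ 3 * r ^ 2 + Rabs delta * L)))%R by (apply Rmult_le_pos; lra).
      lra. }
    apply Rmult_le_compat; [now apply Rmult_le_pos | lra | now apply Rmult_le_compat_l |].
    apply pow_incr; lra.
  - replace (M * (c * (1 + L) ^ 3 * A) * (1 + L) ^ S N)%R with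
      (M * exp k * c * ((1 + L) ^ (S N + 3) * exp (- k * L ^ 3 + Rabs delta * r * L)))%R
      by (rewrite pow_add; unfold A; ring).
    apply Rmult_le_compat_l; [|exact D].
    repeat apply Rmult_le_pos; try lra. left; apply exp_pos.
Qed.

(** Integrated against [w], the Taylor bound (u / L)^N gives L^(-N) times a constant, because the
    decay of [w] absorbs u^N; the constant K of that decay also controls the tail of the polynomial
    integral. *)
Lemma ray_estimate :
  is_RInt_gen (V := CR) (fun s => f (RtoC s * e) * osc 1 s * e) (at_point 0%R) (at_left r) l1 ->
  exists M, (0 <= M)%R /\ forall (L : R) (I J : C), (1 <= L)%R ->
    is_RInt_gen (V := CR) (fun s => f (RtoC s * e) * osc L s * e) (at_point 0%R) (at_left r) I ->
    is_RInt_gen (V := CR) (fun u => psum N a (RtoC u * e * RtoC (/ L)) * w u * e)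
      (at_point 0%R) (Rbar_locally p_infty) J ->
    (Cmod (I - RtoC (/ L) * J) <= M / L ^ S N)%R.
Proof.
  intros H1.
  (* rho / 4 is the range of the Taylor estimate; r / 2 keeps r0 strictly inside the disk. *)
  set (r0 := Rmin (rho / 4) (r / 2)).
  assert (Hr0 : (0 < r0 < r)%R).
  { unfold r0. split; [apply Rmin_pos; lra|].
    pose proof (Rmin_r (rho / 4) (r / 2)). lra. }
  destruct (ray_tail H1 r0 Hr0) as [Mt [HMt Ht]].
  destruct (taylor_remainder a f rho N Hrho Ha) as [MT [HMT HT]].
  destruct (cubic_decay (1 / 3) (delta / 2) N ltac:(lra)) as [K [HK HD]].
  destruct (psum_growth N a) as [A [HA HG]].
  destruct (exp_decay r0 N ltac:(lra)) as [Ke [HKe HE]].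
  assert (Cw : forall u, (0 <= u)%R -> ((1 + u) ^ N * Cmod (w u) <= K * exp (- u))%R).
  { intros u Hu. unfold w. rewrite Cmod_cubic_exp.
    replace (-1 / 3 * u ^ 3)%R with (- (1 / 3) * u ^ 3)%R by field. now apply HD. }
  exists (Mt + MT * K + A * K * Ke)%R. split.
  { pose proof (Rmult_le_pos _ _ HMT HK). pose proof (Rmult_le_pos _ _ HA HK).
    pose proof (Rmult_le_pos (A * K) Ke ltac:(lra) HKe). lra. }
  intros L I J HL HI HJ.
  assert (HLN : (0 < L ^ N)%R) by (apply pow_lt; lra).
  assert (iL : (0 < / L <= 1)%R).
  { split; [apply Rinv_0_lt_compat; lra|]. rewrite <- Rinv_1. apply Rinv_le_contravar; lra. }
  pose (P := fun u : R => psum N a (RtoC u * e * RtoC (/ L)) * w u * e).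
  pose (G := fun u : R => f (RtoC u * e * RtoC (/ L)) * w u * e).
  assert (modz : forall u, (0 <= u)%R -> Cmod (RtoC u * e * RtoC (/ L)) = (u / L)%R).
  { intros u Hu. rewrite !Cmod_mult, e_unit, !Cmod_R, !Rabs_pos_eq by lra. unfold Rdiv; ring. }
  assert (cz : forall u, continuous (U := CR) (fun u : R => RtoC u * e * RtoC (/ L)) u).
  { intros u. apply continuous_Cmult; [apply continuous_ray | apply continuous_const]. }
  assert (cP : forall u, continuous (U := CR) P u).
  { intros u. apply continuous_Cmult; [|apply continuous_const].
    apply continuous_Cmult; [|apply continuous_cubic_exp].
    now apply (psum_continuous N a (fun u : R => RtoC u * e * RtoC (/ L))). }
  assert (dP : forall u, (0 <= u)%R -> (Cmod (P u) <= A * K * exp (- u))%R).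
  { intros u Hu. unfold P. rewrite !Cmod_mult, e_unit, Rmult_1_r.
    apply Rle_trans with (A * (1 + u) ^ N * Cmod (w u))%R.
    - apply Rmult_le_compat_r; [apply Cmod_ge_0|].
      eapply Rle_trans; [apply HG|]. apply Rmult_le_compat_l; [easy|].
      rewrite modz by easy. apply pow_incr.
      assert (0 <= u * / L <= u)%R by nra. unfold Rdiv. lra.
    - rewrite !Rmult_assoc. apply Rmult_le_compat_l; [easy|]. now apply Cw. }
  destruct (dominated_improper_RInt P (A * K) cP dP) as [J' [HJ' HtJ]].
  (* Uniqueness transfers the explicit tail bound to the given [J]. *)
  assert (EJ : J' = J) by exact (is_RInt_gen_Cunique _ _ P J' J HJ' HJ).
  subst J'. clear HJ'.
  set (b := (L * r0)%R).
  assert (Hb : (0 <= b)%R) by (unfold b; nra).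
  assert (ub : forall u, (u <= b)%R -> (u / L <= r0)%R).
  { intros u Hu. apply Rmult_le_reg_r with L; [lra|]. unfold b in Hu.
    unfold Rdiv. rewrite Rmult_assoc, Rinv_l by lra. lra. }
  assert (rP : exists XP, is_RInt (V := CR) P 0 b XP).
  { apply (ex_RInt_continuous (V := C_R_CompleteNormedModule)). intros u _. apply cP. }
  destruct rP as [XP HXP].
  assert (rG : exists XG, is_RInt (V := CR) G 0 b XG).
  { apply (ex_RInt_continuous (V := C_R_CompleteNormedModule)).
    intros u Hu. rewrite Rmin_left, Rmax_right in Hu by lra.
    apply continuous_Cmult; [|apply continuous_const].
    apply continuous_Cmult; [|apply continuous_cubic_exp].
    apply (analytic_continuous f r (fun u : R => RtoC u * e * RtoC (/ L)) u Hf); [|apply cz].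
    rewrite modz by lra. pose proof (ub u ltac:(lra)). lra. }
  destruct rG as [XG HXG].
  (* The substitution u = L s, on the compact piece only. *)
  assert (HI0 : is_RInt (V := CR) (fun s => f (RtoC s * e) * osc L s * e) 0 r0 (RtoC (/ L) * XG)).
  { pose proof (is_RInt_comp_lin (V := CR) G L 0 0 r0 XG) as Q.
    rewrite Rmult_0_r, !Rplus_0_r in Q. specialize (Q HXG).
    apply (is_RInt_Cmult _ _ _ (RtoC (/ L))) in Q.
    refine (is_RInt_ext (V := CR) _ _ _ _ _ _ Q).
    intros s _. cbn beta. rewrite scal_R_Cmult, Rplus_0_r. unfold G.
    replace (w (L * s)) with (osc L s).
    - replace (RtoC (L * s) * e * RtoC (/ L)) with (RtoC s * e).
      + rewrite RtoC_inv by lra.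
        match goal with |- ?u = ?v => change (u = v :> C) end. field.
        intros K0. apply RtoC_inj in K0. lra.
      + rewrite RtoC_mult, RtoC_inv by lra. field. intros K0. apply RtoC_inj in K0. lra.
    - unfold osc, w. rewrite cubic_exp_scale. f_equal; field. }
  specialize (Ht L I _ HL HI HI0).
  assert (D1 : (Cmod (XG - XP) <= MT * K / L ^ N)%R).
  { pose proof (is_RInt_minus (V := CR) _ _ _ _ _ _ HXG HXP) as Q.
    apply Rle_trans with (MT * K / L ^ N * (exp (- 0) - exp (- b)))%R.
    - refine (Cmod_RInt_le _ _ 0 b _ _ Hb _ Q (is_RInt_exp_opp (MT * K / L ^ N) 0 b)).
      intros u Hu. cbn beta.
      change (minus (G u) (P u)) with (G u - P u). unfold G, P.
      replace (f (RtoC u * e * RtoC (/ L)) * w u * e - psum N a (RtoC u * e * RtoC (/ L)) * w u * e)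
        with ((f (RtoC u * e * RtoC (/ L)) - psum N a (RtoC u * e * RtoC (/ L))) * w u * e) by ring.
      rewrite !Cmod_mult, e_unit, Rmult_1_r.
      apply Rle_trans with (MT * (u / L) ^ N * Cmod (w u))%R.
      + apply Rmult_le_compat_r; [apply Cmod_ge_0|].
        rewrite <- (modz u) by lra. apply HT. rewrite modz by lra.
        apply Rle_trans with r0; [apply ub; lra | apply Rmin_l].
      + replace ((u / L) ^ N)%R with (u ^ N / L ^ N)%R
          by (unfold Rdiv; now rewrite Rpow_mult_distr, pow_inv).
        replace (MT * (u ^ N / L ^ N) * Cmod (w u))%R with
          (MT / L ^ N * (u ^ N * Cmod (w u)))%R by (field; lra).
        replace (MT * K / L ^ N * exp (- u))%R with (MT / L ^ N * (K * exp (- u)))%R by (field; lra).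
        apply Rmult_le_compat_l; [apply Rcomplements.Rdiv_le_0_compat; lra|].
        eapply Rle_trans; [|apply Cw; lra].
        apply Rmult_le_compat_r; [apply Cmod_ge_0|]. apply pow_incr; lra.
    - rewrite Ropp_0, exp_0. pose proof (exp_pos (- b)).
      assert (0 <= MT * K / L ^ N)%R
        by (apply Rcomplements.Rdiv_le_0_compat; [now apply Rmult_le_pos | easy]).
      nra. }
  assert (D2 : (Cmod (XP - J) <= A * K * Ke / L ^ N)%R).
  { eapply Rle_trans; [apply (HtJ b XP Hb HXP)|].
    unfold b. rewrite (Rmult_comm L r0). specialize (HE L HL).
    replace (A * K * Ke / L ^ N)%R with (A * K * (Ke / L ^ N))%R by (field; lra).
    apply Rmult_le_compat_l; [now apply Rmult_le_pos | easy]. }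
  replace (I - RtoC (/ L) * J) with
    ((I - RtoC (/ L) * XG) + RtoC (/ L) * ((XG - XP) + (XP - J))) by ring.
  eapply Rle_trans; [apply Cmod_triangle|].
  rewrite Cmod_mult, Cmod_R, Rabs_pos_eq by lra.
  pose proof (Cmod_triangle (XG - XP) (XP - J)) as D3.
  assert (D4 : (/ L * Cmod ((XG - XP) + (XP - J)) <= / L * ((MT * K + A * K * Ke) / L ^ N))%R).
  { apply Rmult_le_compat_l; [lra|].
    replace ((MT * K + A * K * Ke) / L ^ N)%R with (MT * K / L ^ N + A * K * Ke / L ^ N)%R
      by (field; lra). lra. }
  replace ((Mt + MT * K + A * K * Ke) / L ^ S N)%R with
    (Mt / L ^ S N + / L * ((MT * K + A * K * Ke) / L ^ N))%R.
  - lra.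
  - simpl pow. field. split; lra.
Qed.

End Ray.

(** * Integrals over the contour *)

(** Splitting at s0 makes it an endpoint, where [is_RInt_ext] compares nothing. This handles the
    arbitrary value of the integrand of [quad_weight] at its node. *)
Lemma is_RInt_ext_point_le (g g' : R -> C) (a b s0 : R) (I : C) : (a <= b)%R ->
  (forall s, s <> s0 -> g s = g' s) ->
  is_RInt (V := CR) g a b I -> is_RInt (V := CR) g' a b I.
Proof.
  intros Hab Hg HI.
  assert (off : forall u v l, (u <= v)%R -> (s0 <= u \/ v <= s0)%R ->
    is_RInt (V := CR) g u v l -> is_RInt (V := CR) g' u v l).
  { intros u v l Huv H0. apply (is_RInt_ext (V := CR)). intros s Hs.
    rewrite Rmin_left, Rmax_right in Hs by easy. apply Hg. lra. }
  destruct (Rle_lt_dec s0 a) as [H1|H1]; [now apply off; auto|].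
  destruct (Rle_lt_dec b s0) as [H2|H2]; [now apply off; auto|].
  assert (E : ex_RInt (V := C_R_CompleteNormedModule) g a b) by (exists I; exact HI).
  destruct (ex_RInt_Chasles_1 (V := C_R_CompleteNormedModule) g a s0 b ltac:(lra) E) as [I1 K1].
  destruct (ex_RInt_Chasles_2 (V := C_R_CompleteNormedModule) g a s0 b ltac:(lra) E) as [I2 K2].
  pose proof (is_RInt_Chasles (V := CR) g a s0 b I1 I2 K1 K2) as K.
  replace I with (plus (G := CR) I1 I2).
  - apply (is_RInt_Chasles (V := CR) g' a s0 b); apply off; try easy; lra.
  - rewrite <- (is_RInt_unique (V := C_R_CompleteNormedModule) g a b I HI).
    symmetry. now apply (is_RInt_unique (V := C_R_CompleteNormedModule)).
Qed.

Lemma is_RInt_ext_point (g g' : R -> C) (a b s0 : R) (I : C) :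
  (forall s, s <> s0 -> g s = g' s) ->
  is_RInt (V := CR) g a b I -> is_RInt (V := CR) g' a b I.
Proof.
  intros Hg HI. destruct (Rle_lt_dec a b) as [H|H].
  - now apply (is_RInt_ext_point_le g g' a b s0).
  - apply (is_RInt_swap (V := CR)) in HI.
    apply (is_RInt_ext_point_le g g' b a s0) in HI; [|lra|easy].
    apply (is_RInt_swap (V := CR)) in HI.
    replace I with (opp (G := CR) (opp (G := CR) I)); [easy|]. apply opp_opp.
Qed.

(** Both rays are taken outward from 0, so the incoming one enters with a minus sign and the two can
    share every estimate. *)
Definition is_contour_int (F : (R -> Prop) -> Prop) (g : C -> C) (v : C) : Prop :=
  exists v1 v2 : C,
  is_RInt_gen (V := CR) (on_ray (5 * PI / 6) g) (at_point 0%R) F v1 /\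
  is_RInt_gen (V := CR) (on_ray (PI / 6) g) (at_point 0%R) F v2 /\
  v = v2 - v1.

Section Contour.

Variable F : (R -> Prop) -> Prop.
Hypothesis PF : ProperFilter F.

Lemma contour_int_unique (g : C -> C) (v : C) :
  is_contour_int F g v -> contour_int F g = v.
Proof.
  intros [v1 [v2 [H1 [H2 ->]]]]. unfold contour_int.
  assert (PF' : ProperFilter' F) by (apply Proper_StrongProper; exact PF).
  apply (is_RInt_gen_swap (V := CR)) in H1.
  rewrite (is_RInt_gen_unique (V := C_R_CompleteNormedModule) _ _ H1).
  rewrite (is_RInt_gen_unique (V := C_R_CompleteNormedModule) _ _ H2).
  change (- v1 + v2 = v2 - v1). ring.
Qed.

Lemma ex_contour_int_is (g : C -> C) :
  ex_contour_int F g -> exists v, is_contour_int F g v.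
Proof.
  intros [[v1 H1] [v2 H2]]. apply (is_RInt_gen_swap (V := CR)) in H1.
  now exists (v2 - opp (G := CR) v1), (opp (G := CR) v1), v2.
Qed.

Lemma is_RInt_gen_linear (a b : C) (g g' : R -> C) (v v' : C) :
  is_RInt_gen (V := CR) g (at_point 0%R) F v ->
  is_RInt_gen (V := CR) g' (at_point 0%R) F v' ->
  is_RInt_gen (V := CR) (fun s => a * g s + b * g' s) (at_point 0%R) F (a * v + b * v').
Proof.
  intros H H'. apply is_RInt_gen_Cmod; [apply PF|]. intros eps He.
  set (c := (Cmod a + Cmod b + 1)%R).
  pose proof (Cmod_ge_0 a). pose proof (Cmod_ge_0 b).
  assert (He' : (0 < eps / c)%R) by (apply Rdiv_lt_0_compat; unfold c; lra).
  pose proof (proj1 (is_RInt_gen_Cmod F _ g 0 v) H _ He') as K.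
  pose proof (proj1 (is_RInt_gen_Cmod F _ g' 0 v') H' _ He') as K'.
  generalize (filter_and _ _ K K'). apply filter_imp.
  intros y [[I [HI B]] [I' [HI' B']]].
  exists (a * I + b * I'). split.
  - exact (is_RInt_plus (V := CR) _ _ _ _ _ _ (is_RInt_Cmult _ _ _ a _ HI) (is_RInt_Cmult _ _ _ b _ HI')).
  - replace (a * I + b * I' - (a * v + b * v')) with (a * (I - v) + b * (I' - v')) by ring.
    eapply Rle_lt_trans; [apply Cmod_triangle|]. rewrite !Cmod_mult.
    replace eps with (c * (eps / c))%R by (unfold c; field; lra).
    assert (Cmod a * Cmod (I - v) <= Cmod a * (eps / c))%R by (apply Rmult_le_compat_l; lra).
    assert (Cmod b * Cmod (I' - v') <= Cmod b * (eps / c))%R by (apply Rmult_le_compat_l; lra).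
    assert (c * (eps / c) = (Cmod a + Cmod b + 1) * (eps / c))%R by (unfold c; ring). lra.
Qed.

Lemma is_RInt_gen_ext_point (g g' : R -> C) (s0 : R) (v : C) :
  (forall s, s <> s0 -> g s = g' s) ->
  is_RInt_gen (V := CR) g (at_point 0%R) F v -> is_RInt_gen (V := CR) g' (at_point 0%R) F v.
Proof.
  intros Hg H. apply is_RInt_gen_Cmod; [apply PF|]. intros eps He.
  generalize (proj1 (is_RInt_gen_Cmod F _ g 0 v) H _ He). apply filter_imp.
  intros y [I [HI B]]. exists I. split; [|easy].
  now apply (is_RInt_ext_point g g' 0 y s0).
Qed.

(** On both rays Im z = s / 2, so z0 can be met only at s = 2 Im z0. *)
Lemma is_contour_int_ext_point (g g' : C -> C) (z0 v : C) :
  (forall z, z <> z0 -> g z = g' z) -> is_contour_int F g v -> is_contour_int F g' v.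
Proof.
  intros Hg [v1 [v2 [H1 [H2 H3]]]]. exists v1, v2.
  assert (ray : forall theta, sin theta = (1 / 2)%R -> forall s, s <> (2 * snd z0)%R ->
    on_ray theta g s = on_ray theta g' s).
  { intros theta Ht s Hs. unfold on_ray. f_equal. apply Hg. rewrite Cexp_Ci, Ht.
    intros E. apply Hs. rewrite <- E. unfold Cmult; cbn. field. }
  repeat split; [| |easy].
  - refine (is_RInt_gen_ext_point _ _ _ _ (ray _ _) H1).
    replace (5 * PI / 6)%R with (PI - PI / 6)%R by field.
    rewrite sin_PI_x. apply sin_PI6.
  - refine (is_RInt_gen_ext_point _ _ _ _ (ray _ _) H2). apply sin_PI6.
Qed.

Lemma is_contour_int_ext (g g' : C -> C) (v : C) :
  (forall z, g z = g' z) -> is_contour_int F g v -> is_contour_int F g' v.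
Proof. intros Hg. apply (is_contour_int_ext_point g g' 0). intros z _. apply Hg. Qed.

Lemma is_contour_int_linear (a b : C) (g g' : C -> C) (v v' : C) :
  is_contour_int F g v -> is_contour_int F g' v' ->
  is_contour_int F (fun z => a * g z + b * g' z) (a * v + b * v').
Proof.
  intros [v1 [v2 [H1 [H2 ->]]]] [v1' [v2' [H1' [H2' ->]]]].
  exists (a * v1 + b * v1'), (a * v2 + b * v2'). repeat split.
  - refine (is_RInt_gen_ext_point _ _ 0 _ _ (is_RInt_gen_linear a b _ _ _ _ H1 H1')).
    intros s _. unfold on_ray. ring.
  - refine (is_RInt_gen_ext_point _ _ 0 _ _ (is_RInt_gen_linear a b _ _ _ _ H2 H2')).
    intros s _. unfold on_ray. ring.
  - ring.
Qed.

End Contour.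

Lemma Cexp_right_ray : Cexp (Ci * RtoC (PI / 6)) = (sqrt 3 / 2, 1 / 2)%R.
Proof. now rewrite Cexp_Ci, cos_PI6, sin_PI6. Qed.

Lemma Cexp_left_ray : Cexp (Ci * RtoC (5 * PI / 6)) = (- (sqrt 3 / 2), 1 / 2)%R.
Proof.
  rewrite Cexp_Ci. replace (5 * PI / 6)%R with (PI - PI / 6)%R by field.
  rewrite sin_PI_x, sin_PI6, cos_minus, cos_PI, sin_PI, cos_PI6.
  f_equal. ring.
Qed.

Lemma right_ray_sq : ((sqrt 3 / 2) ^ 2 = 3 / 4)%R.
Proof. unfold Rdiv. rewrite Rpow_mult_distr, pow2_sqrt; lra. Qed.

Lemma left_ray_sq : ((- (sqrt 3 / 2)) ^ 2 = 3 / 4)%R.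
Proof. rewrite <- right_ray_sq. ring. Qed.

Lemma gauss_poly_ray (delta x : R) (m : nat) (l : C) (q : C -> C) :
  (x ^ 2 = 3 / 4)%R -> poly_lead m l q ->
  exists v : C, is_RInt_gen (V := CR)
    (fun s => q (RtoC s * (x, 1 / 2)%R) * gauss_weight delta (RtoC s * (x, 1 / 2)%R) * (x, 1 / 2)%R)
    (at_point 0%R) (Rbar_locally p_infty) v.
Proof.
  intros Hx Hq.
  destruct (poly_lead_growth m l q Hq) as [A [HA HG]].
  destruct (cubic_decay (1 / 3) (delta / 2) m ltac:(lra)) as [K [HK HD]].
  destruct (dominated_improper_RInt
    (fun s => q (RtoC s * (x, 1 / 2)%R) * cubic_exp (-1 / 3) (delta / 2) (- (delta * x)) s * (x, 1 / 2)%R)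
    (A * K)) as [v [Hv _]].
  - intros s. apply continuous_Cmult; [|apply continuous_const].
    apply continuous_Cmult; [|apply continuous_cubic_exp].
    apply (poly_lead_continuous m l q (fun s : R => RtoC s * (x, 1 / 2)%R) s Hq).
    apply continuous_ray.
  - intros s Hs. rewrite !Cmod_mult, (e_unit x Hx), Rmult_1_r, Cmod_cubic_exp.
    apply Rle_trans with (A * (1 + s) ^ m * exp (-1 / 3 * s ^ 3 + delta / 2 * s))%R.
    + apply Rmult_le_compat_r; [left; apply exp_pos|].
      specialize (HG (RtoC s * (x, 1 / 2)%R)).
      rewrite Cmod_ray, Rabs_pos_eq in HG by easy. exact HG.
    + rewrite !Rmult_assoc. apply Rmult_le_compat_l; [easy|].
      specialize (HD s Hs). replace (-1 / 3 * s ^ 3)%R with (- (1 / 3) * s ^ 3)%R by field.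
      exact HD.
  - exists v.
    refine (is_RInt_gen_ext_point (Rbar_locally p_infty) _ _ _ 0 _ _ Hv).
    intros s _. now rewrite gauss_weight_on_ray.
Qed.

(** Supplies the convergence that turns an equation for [int_Gamma], such as orthogonality, into a
    statement about [is_contour_int]. *)
Lemma gauss_poly_contour (delta : R) (m : nat) (l : C) (q : C -> C) : poly_lead m l q ->
  is_contour_int (Rbar_locally p_infty) (fun z => q z * gauss_weight delta z)
    (int_Gamma (fun z => q z * gauss_weight delta z)).
Proof.
  intros Hq.
  destruct (gauss_poly_ray delta _ m l q right_ray_sq Hq) as [v2 H2].
  destruct (gauss_poly_ray delta _ m l q left_ray_sq Hq) as [v1 H1].
  assert (H : is_contour_int (Rbar_locally p_infty) (fun z => q z * gauss_weight delta z) (v2 - v1)).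
  { exists v1, v2. repeat split.
    - refine (is_RInt_gen_ext_point (Rbar_locally p_infty) _ _ _ 0 _ _ H1).
      intros s _. unfold on_ray. now rewrite Cexp_left_ray.
    - refine (is_RInt_gen_ext_point (Rbar_locally p_infty) _ _ _ 0 _ _ H2).
      intros s _. unfold on_ray. now rewrite Cexp_right_ray. }
  unfold int_Gamma. now rewrite (contour_int_unique _ _ _ _ H).
Qed.

Lemma gauss_quadrature_exact (n : nat) (delta : R) (p : C -> C) (t : nat -> C) :
  poly_lead n 1 p ->
  (forall k : nat, (k < n)%nat ->
    int_Gamma (fun z => p z * z ^ k * gauss_weight delta z) = RtoC 0) ->
  (forall k : nat, (1 <= k <= n)%nat -> p (t k) = RtoC 0) ->
  (forall j k : nat, (1 <= j <= n)%nat -> (1 <= k <= n)%nat -> t j = t k -> j = k) ->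
  forall (a : nat -> C) (N : nat), (N <= 2 * n)%nat ->
  is_contour_int (Rbar_locally p_infty) (fun z => psum N a z * gauss_weight delta z)
    (sumC (fun k => quad_weight delta p (t k) * psum N a (t k)) 1 n).
Proof.
  intros Hp Horth Hroot Hdist a.
  pose (J := fun (g : C -> C) v => is_contour_int (Rbar_locally p_infty)
                                      (fun z => g z * gauss_weight delta z) v).
  assert (J_ext : forall g g' v, (forall z, g z = g' z) -> J g v -> J g' v).
  { intros g g' v E. apply is_contour_int_ext; [typeclasses eauto|].
    intros z. now rewrite E. }
  assert (J_lin : forall a b g g' v v', J g v -> J g' v' ->
    J (fun z => a * g z + b * g' z) (a * v + b * v')).
  { intros a0 b0 g g' v v' H H'.
    refine (is_contour_int_ext _ _ _ _ _ _ (is_contour_int_linear _ _ a0 b0 _ _ _ _ H H')).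
    intros z. ring. }
  assert (J_0 : J (fun _ => 0) 0).
  { pose proof (gauss_poly_contour delta 0 0 (fun _ => 0) (fun _ => eq_refl)) as H.
    pose proof (J_lin 0 0 _ _ _ _ H H) as H0.
    refine (eq_ind _ (J (fun _ => 0)) (J_ext _ _ _ _ H0) _ _); [intros z|]; ring. }
  assert (mono : forall j, (j < 2 * n)%nat ->
    J (fun z => z ^ j) (sumC (fun k => quad_weight delta p (t k) * t k ^ j) 1 n)).
  (* For n = 0 there is no monomial to check; otherwise the quadrature section applies with n' + 1
     nodes. *)
  { destruct n as [|n']; [lia|]. intros j Hj.
    destruct (node_factors n' p t Hp Hroot Hdist) as [q Hq].
    refine (quadrature_exact n' p t Hp Hroot Hdist J J_ext J_lin J_0
      (fun k => quad_weight delta p (t k)) q Hq _ _ j Hj).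
    - intros k Hk. destruct (Hq k Hk) as [Q1 [Q2 [Q3 _]]].
      assert (Q4 : poly_lead n' (/ q k (t k) * 1 + 0 * 1) (fun z => / q k (t k) * q k z + 0 * q k z))
        by (now apply poly_lead_combine).
      assert (Q5 : poly_lead n' (/ q k (t k) * 1 + 0 * 1) (fun z => q k z / q k (t k))).
      { refine (poly_lead_ext _ _ _ _ _ Q4). intros z. unfold Cdiv. ring. }
      pose proof (gauss_poly_contour delta _ _ _ Q5) as G.
      assert (E : quad_weight delta p (t k) =
        int_Gamma (fun z => q k z / q k (t k) * gauss_weight delta z)).
      (* Away from t k the weight integrand is the cardinal polynomial q k z / q k (t k), since the
         derivative of p at t k is q k (t k). *)
      { unfold quad_weight. apply contour_int_unique; [typeclasses eauto|].
        refine (is_contour_int_ext_point _ _ _ _ (t k) _ _ G).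
        intros z Hz. rewrite (C_derive_factor n' 1 (t k) p (q k) Q1 Q2), Q2. f_equal.
        field. split; [easy | now apply Cminus_eq_contra]. }
      rewrite E. exact G.
    - intros k Hk.
      pose proof (gauss_poly_contour delta _ _ _ (poly_lead_shift _ k _ _ Hp)) as G.
      cbn beta in G. rewrite (Horth k Hk) in G. exact G. }
  induction N as [|N IH]; intros HN.
  - replace (sumC (fun k => quad_weight delta p (t k) * psum 0 a (t k)) 1 n) with (RtoC 0).
    + exact J_0.
    + symmetry. apply sumC_zero. intros k _. cbn. ring.
  - replace (sumC (fun k => quad_weight delta p (t k) * psum (S N) a (t k)) 1 n) with
      (1 * sumC (fun k => quad_weight delta p (t k) * psum N a (t k)) 1 n +
       a N * sumC (fun k => quad_weight delta p (t k) * t k ^ N) 1 n).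
    + refine (J_ext _ _ _ _ (J_lin 1 (a N) _ _ _ _ (IH ltac:(lia)) (mono N ltac:(lia)))).
      intros z. cbn [psum]. ring.
    + clear. induction n as [|n IH].
      * rewrite !sumC_0. ring.
      * rewrite !sumC_S, <- IH. cbn [psum]. ring.
Qed.

(** The nodes are fixed, so each scaled node enters the range rho / 4 of the Taylor estimate once L
    >= |t k| / (rho / 4); L0 is a maximum of these thresholds. *)
Lemma node_error (f : C -> C) (a : nat -> C) (rho : R) (N n : nat) (w t : nat -> C) :
  (0 < rho)%R ->
  (forall h, (Cmod h < rho)%R ->
    is_pseries (K := C_AbsRing) (V := C_NormedModule) a h (f h)) ->
  exists M L0 : R, forall L : R, (L0 <= L)%R -> (1 <= L)%R ->
  (Cmod (sumC (fun k => w k * psum N a (t k * RtoC (/ L))) 1 n -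
         sumC (fun k => w k * f (t k * RtoC (/ L))) 1 n)%C <= M / L ^ N)%R.
Proof.
  intros Hrho Ha.
  destruct (taylor_remainder a f rho N Hrho Ha) as [MT [HMT HT]].
  induction n as [|n [M [L0 IH]]].
  - exists 0%R, 0%R. intros L _ HL. rewrite !sumC_0.
    replace (RtoC 0 - RtoC 0) with (RtoC 0) by ring. rewrite Cmod_0. unfold Rdiv. lra.
  - exists (M + Cmod (w (S n)) * (MT * Cmod (t (S n)) ^ N))%R,
      (Rmax L0 (Cmod (t (S n)) / (rho / 4))).
    intros L HL0 HL.
    pose proof (Rmax_l L0 (Cmod (t (S n)) / (rho / 4))).
    pose proof (Rmax_r L0 (Cmod (t (S n)) / (rho / 4))).
    specialize (IH L ltac:(lra) HL).
    assert (HLN : (0 < L ^ N)%R) by (apply pow_lt; lra).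
    assert (iL : (0 < / L)%R) by (apply Rinv_0_lt_compat; lra).
    set (z := t (S n) * RtoC (/ L)).
    assert (Ez : Cmod z = (Cmod (t (S n)) / L)%R).
    { unfold z. rewrite Cmod_mult, Cmod_R, Rabs_pos_eq by lra. easy. }
    assert (Hz : (Cmod z <= rho / 4)%R).
    { rewrite Ez. apply Rmult_le_reg_r with L; [lra|].
      unfold Rdiv at 1. rewrite Rmult_assoc, Rinv_l, Rmult_1_r by lra.
      replace (Cmod (t (S n))) with (rho / 4 * (Cmod (t (S n)) / (rho / 4)))%R by (field; lra).
      apply Rmult_le_compat_l; lra. }
    specialize (HT z Hz). rewrite Ez in HT.
    rewrite !sumC_S. fold z.
    match goal with |- (Cmod (?s + ?u - (?s' + ?v)) <= _)%R =>
      replace (s + u - (s' + v)) with ((s - s') + - (v - u)) by ring end.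
    eapply Rle_trans; [apply Cmod_triangle|]. rewrite Cmod_opp.
    replace (w (S n) * f z - w (S n) * psum N a z) with (w (S n) * (f z - psum N a z)) by ring.
    rewrite Cmod_mult.
    assert (E : (Cmod (w (S n)) * Cmod (f z - psum N a z) <=
       Cmod (w (S n)) * (MT * (Cmod (t (S n)) / L) ^ N))%R)
      by (apply Rmult_le_compat_l; [apply Cmod_ge_0 | easy]).
    replace ((Cmod (t (S n)) / L) ^ N)%R with (Cmod (t (S n)) ^ N / L ^ N)%R in E
      by (unfold Rdiv; now rewrite Rpow_mult_distr, pow_inv).
    replace ((M + Cmod (w (S n)) * (MT * Cmod (t (S n)) ^ N)) / L ^ N)%R with
      (M / L ^ N + Cmod (w (S n)) * (MT * (Cmod (t (S n)) ^ N / L ^ N)))%R by (field; lra).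
    lra.
Qed.

(** * Powers of omega and the final error bound *)

Lemma cube_root (omega : R) : (0 < omega)%R ->
  (0 < Rpower omega (1 / 3))%R /\ (Rpower omega (1 / 3) ^ 3 = omega)%R /\
  (Rpower omega (2 / 3) = Rpower omega (1 / 3) ^ 2)%R.
Proof.
  intros H. assert (P : (0 < Rpower omega (1 / 3))%R) by apply exp_pos.
  split; [easy|]. split.
  - rewrite <- Rpower_pow, Rpower_mult by easy.
    replace (1 / 3 * INR 3)%R with 1%R by (simpl; field). now apply Rpower_1.
  - rewrite <- Rpower_pow, Rpower_mult by easy. f_equal. simpl; field.
Qed.

Lemma Rpower_error_scale (omega : R) (n : nat) : (0 < omega)%R ->
  Rpower omega (- ((2 * INR n + 1) / 3)) = (/ Rpower omega (1 / 3) ^ S (2 * n))%R.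
Proof.
  intros H. rewrite Rpower_Ropp. f_equal.
  rewrite <- Rpower_pow by apply exp_pos. rewrite Rpower_mult. f_equal.
  rewrite S_INR, mult_INR. simpl. field.
Qed.

Lemma disk_ray (f : C -> C) (omega c delta L x s : R) : (x ^ 2 = 3 / 4)%R ->
  (L ^ 3 = omega)%R -> (omega * c = delta * L)%R ->
  f (RtoC s * (x, 1 / 2)%R) * oscillator omega c (RtoC s * (x, 1 / 2)%R) * (x, 1 / 2)%R =
  f (RtoC s * (x, 1 / 2)%R) * cubic_exp (- L ^ 3 / 3) (delta * L / 2) (- (delta * L * x)) s
    * (x, 1 / 2)%R.
Proof. intros Hx HL Hc. now rewrite oscillator_on_ray, Hc, HL. Qed.

Theorem theorem1p3 (r : R) (hr : (0 < r)%R) (f : C -> C)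
  (hf : analytic_in_disk f r)
  (delta : R) (c : R -> R)
  (hc : forall omega : R, (0 < omega)%R ->
        delta = (c omega * Rpower omega (2 / 3))%R)
  (hI : forall omega : R, (0 < omega)%R ->
        ex_int_Gamma_disk r (fun z => f z * oscillator omega (c omega) z))
  (n : nat) (p : C -> C) (hp : monic_poly n p)
  (horth : forall k : nat, (k < n)%nat ->
           int_Gamma (fun z => p z * z ^ k * gauss_weight delta z) = RtoC 0)
  (t : nat -> C)
  (hroot : forall k : nat, (1 <= k <= n)%nat -> p (t k) = RtoC 0)
  (hdist : forall j k : nat, (1 <= j <= n)%nat -> (1 <= k <= n)%nat ->
           t j = t k -> j = k) :
  bigO_infty (fun omega => RtoC (c omega)) (fun omega => Rpower omega (- (2 / 3)))
  /\
  bigO_infty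
    (fun omega =>
       int_Gamma_disk r (fun z => f z * oscillator omega (c omega) z)
       - quad n delta p t omega f)
    (fun omega => Rpower omega (- ((2 * INR n + 1) / 3))).
Proof.
  split.
  (* Here c is exactly delta omega^(-2/3), so the bound holds with equality. *)
  { exists (Rabs delta), 0%R. intros omega Hom.
    rewrite Cmod_R, (hc omega Hom), <- Rabs_mult, Rpower_Ropp.
    right. f_equal. field. apply Rgt_not_eq, exp_pos. }
  (* omega c = L^3 c = L (c L^2), and c L^2 = delta. *)
  assert (scale : forall omega, (0 < omega)%R ->
    (omega * c omega = delta * Rpower omega (1 / 3))%R).
  { intros omega Hom. destruct (cube_root omega Hom) as [P [E3 E2]].
    rewrite (hc omega Hom), E2. rewrite <- E3 at 1. ring. }
  destruct (hf 0) as [a [rho Ha0]]. { now rewrite Cmod_0. }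
  assert (Ha : forall h, (Cmod h < rho)%R ->
    is_pseries (K := C_AbsRing) (V := C_NormedModule) a h (f h)).
  { intros h Hh. specialize (Ha0 h). replace (h - 0) with h in Ha0 by ring. now apply Ha0. }
  set (N := (2 * n)%nat).
  assert (rays : forall omega, (0 < omega)%R -> exists I1 I2 : C,
    int_Gamma_disk r (fun z => f z * oscillator omega (c omega) z) = I2 - I1 /\
    is_RInt_gen (V := CR) (fun s => f (RtoC s * (- (sqrt 3 / 2), 1 / 2)%R) *
       cubic_exp (- Rpower omega (1 / 3) ^ 3 / 3) (delta * Rpower omega (1 / 3) / 2)
         (- (delta * Rpower omega (1 / 3) * - (sqrt 3 / 2))) s * (- (sqrt 3 / 2), 1 / 2)%R)
       (at_point 0%R) (at_left r) I1 /\
    is_RInt_gen (V := CR) (fun s => f (RtoC s * (sqrt 3 / 2, 1 / 2)%R) *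
       cubic_exp (- Rpower omega (1 / 3) ^ 3 / 3) (delta * Rpower omega (1 / 3) / 2)
         (- (delta * Rpower omega (1 / 3) * (sqrt 3 / 2))) s * (sqrt 3 / 2, 1 / 2)%R)
       (at_point 0%R) (at_left r) I2).
  { intros omega Hom. destruct (cube_root omega Hom) as [P [E3 _]].
    destruct (ex_contour_int_is (at_left r) _ _ (hI omega Hom)) as [v Hv].
    pose proof (contour_int_unique (at_left r) _ _ _ Hv) as E.
    destruct Hv as [I1 [I2 [H1 [H2 ->]]]].
    exists I1, I2. repeat split; [exact E | |].
    - refine (is_RInt_gen_ext_point (at_left r) _ _ _ 0 _ _ H1). intros s _.
      unfold on_ray. rewrite Cexp_left_ray.
      apply (disk_ray f omega (c omega)); [apply left_ray_sq | easy | now apply scale].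
    - refine (is_RInt_gen_ext_point (at_left r) _ _ _ 0 _ _ H2). intros s _.
      unfold on_ray. rewrite Cexp_right_ray.
      apply (disk_ray f omega (c omega)); [apply right_ray_sq | easy | now apply scale]. }
  destruct (rays 1%R Rlt_0_1) as [i1 [i2 [_ [B1 B2]]]].
  assert (one : Rpower 1 (1 / 3) = 1%R).
  { unfold Rpower. now rewrite ln_1, Rmult_0_r, exp_0. }
  rewrite one in B1, B2.
  destruct (ray_estimate r f delta _ a rho N i1 hr hf left_ray_sq (cond_pos rho) Ha B1)
    as [M1 [HM1 T1]].
  destruct (ray_estimate r f delta _ a rho N i2 hr hf right_ray_sq (cond_pos rho) Ha B2)
    as [M2 [HM2 T2]].
  destruct (node_error f a rho N n (fun k => quad_weight delta p (t k)) t (cond_pos rho) Ha)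
    as [M3 [L0 T3]].
  exists (M1 + M2 + M3)%R.
  (* omega > L1^3 forces L >= L1, hence both L >= 1 and the threshold of [node_error]. *)
  set (L1 := Rmax 1 L0).
  exists (L1 ^ 3)%R. intros omega Hbig.
  pose proof (Rmax_l 1 L0) as HL1. pose proof (Rmax_r 1 L0) as HL2. fold L1 in HL1, HL2.
  assert (Hom : (0 < omega)%R).
  { apply Rlt_trans with (L1 ^ 3)%R; [apply pow_lt; lra | easy]. }
  destruct (cube_root omega Hom) as [P [E3 _]].
  destruct (rays omega Hom) as [I1 [I2 [-> [R1 R2]]]].
  rewrite (Rpower_error_scale omega n Hom). fold N. unfold quad.
  set (L := Rpower omega (1 / 3)) in *.
  assert (HL : (L1 <= L)%R).
  { destruct (Rle_lt_dec L1 L) as [H|H]; [easy|].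
    assert (L ^ 3 <= L1 ^ 3)%R by (apply pow_incr; lra). lra. }
  assert (HLN : (0 < L ^ N)%R) by (apply pow_lt; lra).
  assert (G : is_contour_int (Rbar_locally p_infty)
    (fun z => psum N a (z * RtoC (/ L)) * gauss_weight delta z)
    (sumC (fun k => quad_weight delta p (t k) * psum N a (t k * RtoC (/ L))) 1 n)).
  (* The coefficients a j L^(-j) are those of the Taylor polynomial of u -> f(u / L). *)
  { pose proof (gauss_quadrature_exact n delta p t (monic_poly_lead n p hp) horth hroot hdist
      (fun j => a j * RtoC (/ L) ^ j) N (le_n _)) as G.
    refine (eq_ind _ (fun v => is_contour_int _ _ v) _ _ _).
    - refine (is_contour_int_ext _ _ _ _ _ _ G). intros z. cbn beta. now rewrite psum_scale.
    - apply sumC_ext. intros k _. now rewrite psum_scale. }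
  destruct G as [J1 [J2 [G1 [G2 GE]]]].
  assert (F1 : (Cmod (I1 - RtoC (/ L) * J1) <= M1 / L ^ S N)%R).
  { apply (T1 L I1 J1 ltac:(lra) R1).
    refine (is_RInt_gen_ext_point (Rbar_locally p_infty) _ _ _ 0 _ _ G1). intros s _.
    unfold on_ray. rewrite Cexp_left_ray. now rewrite gauss_weight_on_ray by apply left_ray_sq. }
  assert (F2 : (Cmod (I2 - RtoC (/ L) * J2) <= M2 / L ^ S N)%R).
  { apply (T2 L I2 J2 ltac:(lra) R2).
    refine (is_RInt_gen_ext_point (Rbar_locally p_infty) _ _ _ 0 _ _ G2). intros s _.
    unfold on_ray. rewrite Cexp_right_ray. now rewrite gauss_weight_on_ray by apply right_ray_sq. }
  specialize (T3 L ltac:(lra) ltac:(lra)). rewrite GE in T3.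
  assert (iL : (0 < / L)%R) by (apply Rinv_0_lt_compat; lra).
  replace (sum_n_m (fun k => quad_weight delta p (t k) * f (t k / RtoC L)) 1 n) with
    (sumC (fun k => quad_weight delta p (t k) * f (t k * RtoC (/ L))) 1 n).
  2: { apply sumC_ext. intros k _. now rewrite RtoC_inv by lra. }
  set (S3 := sumC (fun k => quad_weight delta p (t k) * f (t k * RtoC (/ L))) 1 n) in *.
  rewrite <- RtoC_inv by lra.
  (* J2 - J1 is the rule applied to the Taylor polynomial, so the last term is the node error with
     its extra factor 1 / L. *)
  replace (I2 - I1 - RtoC (/ L) * S3) with
    ((I2 - RtoC (/ L) * J2) + - (I1 - RtoC (/ L) * J1) + RtoC (/ L) * (J2 - J1 - S3)) by ring.
  eapply Rle_trans; [apply Cmod_triangle|].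
  rewrite Cmod_mult, Cmod_R, (Rabs_pos_eq (/ L)) by lra.
  pose proof (Cmod_triangle (I2 - RtoC (/ L) * J2) (- (I1 - RtoC (/ L) * J1))) as F3.
  rewrite Cmod_opp in F3.
  assert (F4 : (/ L * Cmod (J2 - J1 - S3) <= / L * (M3 / L ^ N))%R)
    by (apply Rmult_le_compat_l; lra).
  rewrite Rabs_pos_eq.
  - replace ((M1 + M2 + M3) * / L ^ S N)%R with
      (M2 / L ^ S N + M1 / L ^ S N + / L * (M3 / L ^ N))%R
      by (simpl pow; field; split; lra).
    lra.
  - left. apply Rinv_0_lt_compat, pow_lt. lra.
Qed.
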